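(* For $d\in[1/2,+\infty)$ and $r\in[1,+\infty)$ let $G=G_{d,1-d,r}:[0,2]\to\mathbb R$ be the two-lane flux function defined in the context. Let $$\widetilde d_1:=\frac12+\frac16\sqrt{3+2\sqrt3},\qquad \widetilde d_0:=\frac12+\frac{\sqrt3}{4},\qquad \overline d_1:=\frac12+\frac14\sqrt{2\sqrt3},$$ which satisfy $\frac12<\widetilde d_1<\widetilde d_0<\overline d_1$. Then there exist functions of $d$ $$\overline r_1:[1/2,\overline d_1]\to[1,+\infty),\qquad r_3:[\widetilde d_1,+\infty)\to[1,+\infty),\qquad r_4:[\widetilde d_1,1)\to[1,+\infty)$$ with the following properties. 1.(i) $r_4$ is increasing, $\overline r_1$ and $r_3$ are decreasing, all three are continuous, and $\lim_{d\to1-}r_4(d)=+\infty$. 1.(ii) For $d\in[\widetilde d_1,\overline d_1]$: if $d=\widetilde d_0$ then $\overline r_1(d)=r_3(d)$; if $d\ne\widetilde d_0$ then $\overline r_1(d)<r_3(d)$. 2.(i) For $d\in[1/2,\widetilde d_1)$: if $r\le\overline r_1(d)$, $G$ is strictly concave; if $r>\overline r_1(d)$, $G$ has two inflexion points. 2.(ii) For $d\in[\widetilde d_1,\widetilde d_0)$: if $r\le\overline r_1(d)$, $G$ is strictly concave; if $\overline r_1(d)<r<r_3(d)$ or $r>r_4(d)$, $G$ has two inflexion points; if $r_3(d)\le r\le r_4(d)$, $G$ has a single inflexion point. 2.(iii) For $d\in[\widetilde d_0,1)$: if $r\le r_3(d)$, $G$ is strictly concave; if $r_3(d)<r<r_4(d)$,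 $G$ has a single inflexion point; if $r>r_4(d)$, $G$ has two inflexion points. 2.(iv) For $d=1$: if $r\le r_3(1)=1+\sqrt2$, $G$ is strictly concave; if $r>r_3(1)$, $G$ has a single inflexion point. 2.(v) For $d\in(1,+\infty)$: if $r\le r_3(d)$, $G$ is positive on $(0,2)$ and strictly concave; if $r_3(d)<r\le\frac{d}{d-1}$, $G$ is positive on $(0,2)$ and has a single inflexion point; if $r>\frac{d}{d-1}$, $G$ has a single inflexion point and a single zero on $(0,2)$, is positive with a single local maximum on the left of this zero, and negative with a single local minimum on the right of it.
   Context: For $\gamma_0,\gamma_1\in\mathbb R$ and $r\in(0,+\infty)$, the two-lane flux function $G_{\gamma_0,\gamma_1,r}:[0,2]\to\mathbb R$ is $$G_{\gamma_0,\gamma_1,r}(\rho)=(\gamma_0+\gamma_1)\frac\rho2\Big(1-\frac\rho2\Big)+(\gamma_0-\gamma_1)(1-\rho)\varphi(\rho)-(\gamma_0+\gamma_1)\varphi(\rho)^2,$$ where $\varphi\equiv0$ if $r=1$, and for $r\neq1$ $$\varphi(\rho)=\frac12\,\frac{r+1}{r-1}\Big(1-\sqrt{\psi(\rho)}\Big),\qquad \psi(\rho)=1+\Big(\frac{r-1}{r+1}\Big)^2\rho(\rho-2).$$ (It is the flux of the two-lane exclusion process with lane drifts $\gamma_0,\gamma_1$ and interlane rates $q(0,1)=p$, $q(1,0)=q$, $r=q/p$.) An inflexion point of $G$ is a point of the open interval $(0,2)$ at which $G''$ changes sign; ''two'' and ''a single'' mean exactly two and exactly one. Strict concavity is on $[0,2]$.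 ''Increasing'' and ''decreasing'' are meant as functions of $d$. *)

(* Defs.v *)
From Stdlib Require Import Reals.
From Coquelicot Require Import Coquelicot.
Open Scope R_scope.

Definition psi (r rho : R) : R :=
  1 + ((r - 1) / (r + 1)) ^ 2 * (rho * (rho - 2)).

Definition phi (r rho : R) : R :=
  if Req_EM_T r 1 then 0
  else 1 / 2 * ((r + 1) / (r - 1)) * (1 - sqrt (psi r rho)).

(* The flux is a function on [0,2]; the formula is smooth on all of R for r > 0
   (there psi r rho > 0), and below only points of [0,2] are ever considered. *)
Definition two_lane_flux (gamma0 gamma1 r rho : R) : R :=
  (gamma0 + gamma1) * (rho / 2) * (1 - rho / 2)
  + (gamma0 - gamma1) * (1 - rho) * phi r rho
  - (gamma0 + gamma1) * phi r rho ^ 2.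

Definition d1_tilde : R := 1 / 2 + 1 / 6 * sqrt (3 + 2 * sqrt 3).
Definition d0_tilde : R := 1 / 2 + sqrt 3 / 4.
Definition d1_bar : R := 1 / 2 + 1 / 4 * sqrt (2 * sqrt 3).

Definition increasing_on (D : R -> Prop) (f : R -> R) : Prop :=
  forall x y, D x -> D y -> x < y -> f x < f y.

Definition decreasing_on (D : R -> Prop) (f : R -> R) : Prop :=
  forall x y, D x -> D y -> x < y -> f y < f x.

Definition strictly_concave_on (D : R -> Prop) (f : R -> R) : Prop :=
  forall x y t, D x -> D y -> x <> y -> 0 < t < 1 ->
    t * f x + (1 - t) * f y < f (t * x + (1 - t) * y).

Definition changes_sign_at (f : R -> R) (x : R) : Prop :=
  exists eps, 0 < eps /\
    (((forall y, x - eps < y < x -> f y < 0) /\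
      (forall y, x < y < x + eps -> 0 < f y)) \/
     ((forall y, x - eps < y < x -> 0 < f y) /\
      (forall y, x < y < x + eps -> f y < 0))).

Definition inflexion_point (G : R -> R) (x : R) : Prop :=
  0 < x < 2 /\ changes_sign_at (Derive_n G 2) x.

Definition exactly_two (P : R -> Prop) : Prop :=
  exists x y, x <> y /\ forall z, P z <-> z = x \/ z = y.

Definition strictly_concave (G : R -> R) : Prop :=
  strictly_concave_on (fun x => 0 <= x <= 2) G.

Definition two_inflexion_points (G : R -> R) : Prop :=
  exactly_two (inflexion_point G).

Definition single_inflexion_point (G : R -> R) : Prop :=
  exists! x, inflexion_point G x.

Definition positive_on (D : R -> Prop) (f : R -> R) : Prop :=
  forall x, D x -> 0 < f x.

Definition negative_on (D : R -> Prop) (f : R -> R) : Prop :=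
  forall x, D x -> f x < 0.

Definition local_max (f : R -> R) (x : R) : Prop :=
  locally x (fun y => f y <= f x).

Definition local_min (f : R -> R) (x : R) : Prop :=
  locally x (fun y => f x <= f y).

(* Main.v *)
Require Import Defs.
From Stdlib Require Import Reals.
From Coquelicot Require Import Coquelicot.
From Stdlib Require Import Lra Psatz ClassicalEpsilon.
Open Scope R_scope.

(** In the variable [t = T (1 - rho)], with [T = hT r = (r - 1) / (2 sqrt r)],
    [hS t = sqrt (1 + t ^ 2)] and [m = 2 d - 1], one finds
    [G'' = (hS T - hF m t) / (2 (hS t) ^ 3)], where [hF m t = m (3 t + 2 t ^ 3) + 2 (hS t) ^ 3]
    no longer depends on [r].  For [m < 1] the function [hF m] decreases up to [- tau m] and
    increases afterwards; for [m >= 1] it increases.  Since always [hF m T > hS T], the inflexion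
    points, with [- T < t < T], are counted by the signs of [hF m (- T) - hS T] and
    [hF m (- tau m) - hS T].  The first is the sign of [hg r - m] for a rational function [hg] that
    decreases and then increases, whose two inverse branches are [r3] and [r4]; the second vanishes
    at an explicit [r = r1_bar d].  The sign of [G] is that of [hS t + m t]. *)

(** * Concavity, sign changes and continuity of inverses *)

(** Writing [t = sinh x] gives [hS t = cosh x], and the derivative of [hF m] in [t] becomes
    [3 (m cosh 2x + sinh 2x)], which vanishes where [tanh 2x = - m]. The obstacle is that the
    minimum of [hF m] matters only when its place [- tau m] lies inside [(- T, T)]; otherwise the
    value at the endpoint [- T] decides alone. With [y = sqrt (1 - m ^ 2)] the squared minimum is
    [2 y + 2 y ^ 2] and [tau m ^ 2 = (1 - y) / (2 y)], so at [r = r1_bar d] the inequality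
    [tau m < T] reads [0 < (y + 1) (4 y ^ 2 - 1)]. Hence the three constants: [d0_tilde] is the
    drift with [y = 1 / 2], where the minimiser reaches the endpoint just as the minimum reaches
    [hS T]; [d1_bar] is the drift for which the minimum of [hF m] equals 1, so that [r1_bar] has
    come down to 1; [2 * d1_tilde - 1] is the least value of [hg], so for smaller drifts the
    endpoint value always exceeds [hS T]. The case [r = 1], where [T = 0], is treated apart. *)

Lemma lt_of_sq_lt x y : 0 <= y -> x ^ 2 < y ^ 2 -> x < y.
Proof. intros; nra. Qed.

Lemma le_of_sq_le x y : 0 <= y -> x ^ 2 <= y ^ 2 -> x <= y.
Proof. intros; nra. Qed.

Lemma eq_of_sq_eq x y : 0 <= x -> 0 <= y -> x ^ 2 = y ^ 2 -> x = y.
Proof. intros; nra. Qed.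

Lemma sqrt_sq x : 0 <= x -> sqrt x ^ 2 = x.
Proof. intros; rewrite <- Rsqr_pow2; now apply Rsqr_sqrt. Qed.

Lemma decreasing_of_derive (f df : R -> R) (a b : R) :
  (forall x, is_derive f x (df x)) -> (forall x, a < x < b -> df x < 0) ->
  forall x y, a <= x -> x < y -> y <= b -> f y < f x.
Proof.
intros Hf Hd x y ax xy yb.
destruct (MVT_cor2 f df x y xy) as [c [Hc Hxc]].
{ intros c _; apply is_derive_Reals, Hf. }
assert (df c < 0) by (apply Hd; lra).
nra.
Qed.

Lemma increasing_of_derive (f df : R -> R) (a b : R) :
  (forall x, is_derive f x (df x)) -> (forall x, a < x < b -> 0 < df x) ->
  forall x y, a <= x -> x < y -> y <= b -> f x < f y.
Proof.
intros Hf Hd x y ax xy yb.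
destruct (MVT_cor2 f df x y xy) as [c [Hc Hxc]].
{ intros c _; apply is_derive_Reals, Hf. }
assert (0 < df c) by (apply Hd; lra).
nra.
Qed.

(** One exceptional point [z] is allowed because at [r = r1_bar d], for [d < d0_tilde], the second
    derivative touches 0 inside the interval. The first derivative still decreases strictly across
    [z]; the mean value theorem on both sides of the mixed point then gives the inequality. *)
Lemma strictly_concave_of_derive2 (f df ddf : R -> R) (z : R) :
  (forall x, is_derive f x (df x)) -> (forall x, is_derive df x (ddf x)) ->
  (forall x, 0 < x < 2 -> x <> z -> ddf x < 0) ->
  strictly_concave f.
Proof.
intros Hf Hdf Hneg.
assert (Hdec : forall x y, 0 <= x -> x < y -> y <= 2 -> df y < df x).
{ assert (Hoff : forall x y, 0 <= x -> x < y -> y <= 2 ->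
    ~ x < z < y -> df y < df x).
  { intros x y Hx Hxy Hy Hz.
    apply (decreasing_of_derive df ddf x y); try lra; auto.
    intros c Hc; apply Hneg; lra. }
  intros x y Hx Hxy Hy.
  destruct (Rlt_dec x z) as [xz | xz]; [| apply Hoff; lra].
  destruct (Rlt_dec z y) as [zy | zy]; [| apply Hoff; lra].
  apply Rlt_trans with (df z); apply Hoff; lra. }
assert (Hlt : forall x y t, 0 <= x -> x < y -> y <= 2 -> 0 < t < 1 ->
  t * f x + (1 - t) * f y < f (t * x + (1 - t) * y)).
{ intros x y t Hx Hxy Hy Ht.
  set (w := t * x + (1 - t) * y).
  assert (Hw : x < w < y) by (unfold w; nra).
  destruct (MVT_cor2 f df x w) as [c1 [E1 H1]]; [lra | |].
  { intros c _; apply is_derive_Reals, Hf. }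
  destruct (MVT_cor2 f df w y) as [c2 [E2 H2]]; [lra | |].
  { intros c _; apply is_derive_Reals, Hf. }
  assert (df c2 < df c1) by (apply Hdec; lra).
  replace (w - x) with ((1 - t) * (y - x)) in E1 by (unfold w; ring).
  replace (y - w) with (t * (y - x)) in E2 by (unfold w; ring).
  assert (0 < t * (1 - t) * (y - x)).
  { apply Rmult_lt_0_compat; [nra | lra]. }
  assert (E : f w - (t * f x + (1 - t) * f y)
    = t * (1 - t) * (y - x) * (df c1 - df c2)).
  { replace (f w - (t * f x + (1 - t) * f y))
      with (t * (f w - f x) - (1 - t) * (f y - f w)) by ring.
    rewrite E1, E2; ring. }
  assert (0 < t * (1 - t) * (y - x) * (df c1 - df c2))
    by (apply Rmult_lt_0_compat; lra).
  lra. }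
intros x y t Hx Hy Hne Ht.
destruct (Rlt_dec x y) as [xy | xy].
- apply Hlt; lra.
- replace (t * f x + (1 - t) * f y) with
    ((1 - t) * f y + (1 - (1 - t)) * f x) by ring.
  replace (t * x + (1 - t) * y) with
    ((1 - t) * y + (1 - (1 - t)) * x) by ring.
  apply Hlt; lra.
Qed.

Lemma positive_of_strictly_concave f :
  strictly_concave f -> f 0 = 0 -> f 2 = 0 ->
  positive_on (fun x => 0 < x < 2) f.
Proof.
intros H f0 f2 x Hx.
generalize (H 2 0 (x / 2) ltac:(lra) ltac:(lra) ltac:(lra) ltac:(lra)).
rewrite f0, f2.
replace (x / 2 * 2 + (1 - x / 2) * 0) with x by field.
lra.
Qed.

(** This covers a valley and a monotone function at once, so roots of [hF m] are counted without
    separating [m < 1] from [m >= 1]. Applied to the first derivative of the flux, it bounds the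
    number of critical points by two. *)
Definition strictly_quasiconvex_on (D : R -> Prop) (f : R -> R) : Prop :=
  forall x y z, D x -> D z -> x < y < z -> f y < f x \/ f y < f z.

Lemma quasiconvex_of_unimodal (a b c : R) (f : R -> R) :
  (forall x y, a <= x -> x < y -> y <= c -> f y < f x) ->
  (forall x y, c <= x -> x < y -> y <= b -> f x < f y) ->
  strictly_quasiconvex_on (fun x => a <= x <= b) f.
Proof.
intros Hd Hi x y z Hx Hz Hy.
destruct (Rle_dec y c); [left; apply Hd | right; apply Hi]; lra.
Qed.

Lemma changes_sign_not_pos f x l h :
  l < x < h -> (forall y, l < y < h -> y <> x -> 0 < f y) ->
  ~ changes_sign_at f x.
Proof.
intros Hx Hf [eps [He Hs]].
set (y1 := (x + Rmax l (x - eps)) / 2).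
set (y2 := (x + Rmin h (x + eps)) / 2).
assert (H1 : l < y1 < x /\ x - eps < y1).
{ unfold y1, Rmax; destruct (Rle_dec l (x - eps)); lra. }
assert (H2 : x < y2 < h /\ y2 < x + eps).
{ unfold y2, Rmin; destruct (Rle_dec h (x + eps)); lra. }
assert (0 < f y1) by (apply Hf; lra).
assert (0 < f y2) by (apply Hf; lra).
destruct Hs as [[Hl _] | [_ Hr]].
- assert (f y1 < 0) by (apply Hl; lra); lra.
- assert (f y2 < 0) by (apply Hr; lra); lra.
Qed.

Lemma changes_sign_opp f x :
  changes_sign_at f x -> changes_sign_at (fun y => - f y) x.
Proof.
intros [eps [He Hs]]; exists eps; split; [easy|].
destruct Hs as [[Hl Hr] | [Hl Hr]]; [right | left]; split; intros y Hy;
  first [generalize (Hl y Hy) | generalize (Hr y Hy)]; lra.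
Qed.

Lemma changes_sign_not_neg f x l h :
  l < x < h -> (forall y, l < y < h -> y <> x -> f y < 0) ->
  ~ changes_sign_at f x.
Proof.
intros Hx Hf Hs.
apply (changes_sign_not_pos (fun y => - f y) x l h Hx); [| now apply changes_sign_opp].
intros y Hy Hne; generalize (Hf y Hy Hne); lra.
Qed.

Lemma changes_sign_up f l x h :
  l < x < h -> (forall y, l < y < x -> f y < 0) -> (forall y, x < y < h -> 0 < f y) ->
  changes_sign_at f x.
Proof.
intros Hx Hl Hr.
exists (Rmin (x - l) (h - x)); split.
{ unfold Rmin; destruct (Rle_dec (x - l) (h - x)); lra. }
generalize (Rmin_l (x - l) (h - x)) (Rmin_r (x - l) (h - x)); intros.
left; split; intros y Hy; [apply Hl | apply Hr]; lra.
Qed.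

Lemma changes_sign_down f l x h :
  l < x < h -> (forall y, l < y < x -> 0 < f y) -> (forall y, x < y < h -> f y < 0) ->
  changes_sign_at f x.
Proof.
intros Hx Hl Hr.
exists (Rmin (x - l) (h - x)); split.
{ unfold Rmin; destruct (Rle_dec (x - l) (h - x)); lra. }
generalize (Rmin_l (x - l) (h - x)) (Rmin_r (x - l) (h - x)); intros.
right; split; intros y Hy; [apply Hl | apply Hr]; lra.
Qed.

Lemma single_inflexion_of_sign (G : R -> R) x0 :
  0 < x0 < 2 ->
  (forall x, 0 < x < x0 -> Derive_n G 2 x < 0) ->
  (forall x, x0 < x < 2 -> 0 < Derive_n G 2 x) ->
  single_inflexion_point G.
Proof.
intros H0 Hl Hr; exists x0; split.
- split; [easy | now apply (changes_sign_up _ 0 x0 2)].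
- intros x [Hx Hs].
  destruct (Rtotal_order x x0) as [Hlt | [-> | Hgt]]; [exfalso | easy | exfalso].
  + revert Hs; apply (changes_sign_not_neg _ x 0 x0); [lra|].
    intros y Hy _; now apply Hl.
  + revert Hs; apply (changes_sign_not_pos _ x x0 2); [lra|].
    intros y Hy _; now apply Hr.
Qed.

Lemma two_inflexions_of_sign (G : R -> R) x1 x2 :
  0 < x1 < x2 -> x2 < 2 ->
  (forall x, 0 < x < x1 -> Derive_n G 2 x < 0) ->
  (forall x, x1 < x < x2 -> 0 < Derive_n G 2 x) ->
  (forall x, x2 < x < 2 -> Derive_n G 2 x < 0) ->
  two_inflexion_points G.
Proof.
intros H1 H2 Hl Hm Hr; exists x1, x2; split; [lra|].
intros x; split.
- intros [Hx Hs].
  destruct (Rtotal_order x x1) as [Hlt | [-> | Hgt]]; [exfalso | now left |].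
  { revert Hs; apply (changes_sign_not_neg _ x 0 x1); [lra|].
    intros y Hy _; now apply Hl. }
  destruct (Rtotal_order x x2) as [Hlt' | [-> | Hgt']]; [exfalso | now right | exfalso].
  + revert Hs; apply (changes_sign_not_pos _ x x1 x2); [lra|].
    intros y Hy _; now apply Hm.
  + revert Hs; apply (changes_sign_not_neg _ x x2 2); [lra|].
    intros y Hy _; now apply Hr.
- intros [-> | ->]; (split; [lra|]).
  + apply (changes_sign_up _ 0 x1 x2); auto; lra.
  + apply (changes_sign_down _ x1 x2 2); auto; lra.
Qed.

(** A point [y] of [I] slightly above [h d] has [f y < d], and every [d' > f y] has [h d' < y];
    symmetrically below. So monotonicity of [f] on an interval alone controls the inverse. *)
Lemma continuous_on_left_inverse_decreasing (D I : R -> Prop) (f h : R -> R) :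
  (forall x y z, I x -> I z -> x < y < z -> I y) ->
  decreasing_on I f ->
  (forall d, D d -> I (h d) /\ f (h d) = d) ->
  continuous_on D h.
Proof.
intros Hconv Hf Hh d Dd.
destruct (Hh d Dd) as [Id Ed].
apply filterlim_locally; intros eps.
unfold within.
assert (He := cond_pos eps).
assert (Hup : locally d (fun d' => D d' -> h d' < h d + eps)).
{ destruct (excluded_middle_informative (exists y, I y /\ h d < y < h d + eps))
    as [[y [Iy Hy]] | Hn].
  - assert (Hfy : f y < d) by (rewrite <- Ed; apply Hf; lra || auto).
    apply (filter_imp (fun d' => f y < d')); [| now apply open_gt].
    intros d' Hd' Dd'; destruct (Hh d' Dd') as [Id' Ed'].
    destruct (Rlt_dec (h d') (h d + eps)) as [|Hge]; [easy | exfalso].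
    assert (f (h d') < f y) by (apply Hf; lra || auto); lra.
  (* Here [I] has no point just above [h d]; a value of [h] beyond that gap would contradict the
     convexity of [I]. *)
  - apply filter_forall; intros d' Dd'; destruct (Hh d' Dd') as [Id' Ed'].
    destruct (Rlt_dec (h d') (h d + eps)) as [|Hge]; [easy | exfalso].
    apply Hn; exists (h d + eps / 2); split; [| lra].
    apply (Hconv (h d) _ (h d')); auto; lra. }
assert (Hlow : locally d (fun d' => D d' -> h d - eps < h d')).
{ destruct (excluded_middle_informative (exists y, I y /\ h d - eps < y < h d))
    as [[y [Iy Hy]] | Hn].
  - assert (Hfy : d < f y) by (rewrite <- Ed; apply Hf; lra || auto).
    apply (filter_imp (fun d' => d' < f y)); [| now apply open_lt].
    intros d' Hd' Dd'; destruct (Hh d' Dd') as [Id' Ed'].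
    destruct (Rlt_dec (h d - eps) (h d')) as [|Hge]; [easy | exfalso].
    assert (f y < f (h d')) by (apply Hf; lra || auto); lra.
  - apply filter_forall; intros d' Dd'; destruct (Hh d' Dd') as [Id' Ed'].
    destruct (Rlt_dec (h d - eps) (h d')) as [|Hge]; [easy | exfalso].
    apply Hn; exists (h d - eps / 2); split; [| lra].
    apply (Hconv (h d') _ (h d)); auto; lra. }
apply (filter_imp (fun d' => (D d' -> h d' < h d + eps) /\ (D d' -> h d - eps < h d')));
  [| now apply filter_and].
intros d' [H1 H2] Dd'.
specialize (H1 Dd'); specialize (H2 Dd').
unfold ball; simpl; unfold AbsRing_ball, abs, minus, plus, opp; simpl.
apply Rabs_def1; lra.
Qed.

Lemma continuous_on_left_inverse_increasing (D I : R -> Prop) (f h : R -> R) :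
  (forall x y z, I x -> I z -> x < y < z -> I y) ->
  increasing_on I f ->
  (forall d, D d -> I (h d) /\ f (h d) = d) ->
  continuous_on D h.
Proof.
intros Hconv Hf Hh.
assert (H : continuous_on D (fun d => - h d)).
{ apply (continuous_on_left_inverse_decreasing D (fun x => I (- x)) (fun x => f (- x))).
  - intros x y z Ix Iz Hy; apply (Hconv (- z) _ (- x)); auto; lra.
  - intros x y Ix Iy Hxy; apply Hf; auto; lra.
  - intros d Dd; rewrite Ropp_involutive; auto. }
apply (continuous_on_ext D (fun d => - - h d)).
{ intros d _; apply Ropp_involutive. }
intros d Dd.
apply (filterlim_comp _ _ _ (fun d => - h d) Ropp _ (locally (- h d)) _ (H d Dd)).
apply (filterlim_opp (- h d)).
Qed.

(** * The flux in the variable [t] *)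

Definition hS (t : R) : R := sqrt (1 + t ^ 2).
Definition hT (r : R) : R := (r - 1) / (2 * sqrt r).
Definition hF (m t : R) : R := m * (3 * t + 2 * t ^ 3) + 2 * hS t ^ 3.

Lemma hS_pos t : 0 < hS t.
Proof. apply sqrt_lt_R0; nra. Qed.

Lemma hS_sq t : hS t ^ 2 = 1 + t ^ 2.
Proof. apply sqrt_sq; nra. Qed.

Lemma hS_unique t s : 0 <= s -> s ^ 2 = 1 + t ^ 2 -> hS t = s.
Proof.
intros Hs E; apply eq_of_sq_eq; [apply Rlt_le, hS_pos | easy | now rewrite hS_sq].
Qed.

Lemma hS_opp t : hS (- t) = hS t.
Proof. unfold hS; f_equal; ring. Qed.

Lemma hS_ge1 t : 1 <= hS t.
Proof. generalize (hS_sq t) (hS_pos t); nra. Qed.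

Lemma hS_lt s t : 0 <= s < t -> hS s < hS t.
Proof. intros; apply sqrt_lt_1; nra. Qed.

Lemma hS_derive t : is_derive hS t (t / hS t).
Proof.
unfold hS; auto_derive; [nra|].
simpl; field; apply Rgt_not_eq, sqrt_lt_R0; nra.
Qed.

Lemma hT_pos r : 1 < r -> 0 < hT r.
Proof.
intros Hr; assert (0 < sqrt r) by (apply sqrt_lt_R0; lra).
apply Rdiv_lt_0_compat; lra.
Qed.

Lemma hS_hT r : 0 < r -> hS (hT r) = (r + 1) / (2 * sqrt r).
Proof.
intros Hr; assert (Hs : 0 < sqrt r) by (apply sqrt_lt_R0; lra).
assert (E := sqrt_sq r (Rlt_le _ _ Hr)).
apply hS_unique.
- apply Rlt_le, Rdiv_lt_0_compat; lra.
- unfold hT.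
  replace (((r + 1) / (2 * sqrt r)) ^ 2) with ((r + 1) ^ 2 / (4 * sqrt r ^ 2)) by (field; lra).
  replace (((r - 1) / (2 * sqrt r)) ^ 2) with ((r - 1) ^ 2 / (4 * sqrt r ^ 2)) by (field; lra).
  rewrite E; field; lra.
Qed.

(* [r = e ^ (2 x)] when [T = sinh x]. *)
Definition hR (T : R) : R := (T + hS T) ^ 2.

Lemma hR_ge1 T : 0 <= T -> 1 <= hR T.
Proof. intros; unfold hR; generalize (hS_ge1 T); nra. Qed.

Lemma hR_gt1 T : 0 < T -> 1 < hR T.
Proof. intros; unfold hR; generalize (hS_ge1 T); nra. Qed.

Lemma hR_lt s t : 0 <= s < t -> hR s < hR t.
Proof.
intros H; unfold hR; generalize (hS_lt s t H) (hS_pos s); nra.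
Qed.

Lemma hT_hR T : 0 <= T -> hT (hR T) = T.
Proof.
intros HT; unfold hT, hR.
assert (Hs := hS_pos T); assert (E := hS_sq T).
rewrite sqrt_pow2 by lra.
apply Rmult_eq_reg_r with (2 * (T + hS T)); [| lra].
replace (((T + hS T) ^ 2 - 1) / (2 * (T + hS T)) * (2 * (T + hS T)))
  with ((T + hS T) ^ 2 - 1) by (field; lra).
nra.
Qed.

Lemma hR_hT r : 1 <= r -> hR (hT r) = r.
Proof.
intros Hr; unfold hR; rewrite hS_hT by lra; unfold hT.
assert (Hs : 0 < sqrt r) by (apply sqrt_lt_R0; lra).
replace ((r - 1) / (2 * sqrt r) + (r + 1) / (2 * sqrt r)) with (r / sqrt r) by (field; lra).
replace ((r / sqrt r) ^ 2) with (r ^ 2 / sqrt r ^ 2) by (field; lra).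
rewrite sqrt_sq by lra; field; lra.
Qed.

Lemma hT_ge0 r : 1 <= r -> 0 <= hT r.
Proof.
intros Hr; assert (0 < sqrt r) by (apply sqrt_lt_R0; lra).
apply Rle_mult_inv_pos; lra.
Qed.

Lemma hT_lt r s : 1 <= r < s -> hT r < hT s.
Proof.
intros H; destruct (Rlt_le_dec (hT r) (hT s)) as [|Hle]; [easy | exfalso].
assert (H0 : 0 <= hT s) by (apply hT_ge0; lra).
destruct Hle as [Hlt | E].
- generalize (hR_lt (hT s) (hT r) (conj H0 Hlt)); rewrite !hR_hT; lra.
- assert (E' : hR (hT s) = hR (hT r)) by now rewrite E.
  rewrite !hR_hT in E'; lra.
Qed.

(** Since [(r - 1) / (r + 1) = T / hS T] and [psi = (hS t / hS T) ^ 2], [phi] becomes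
    [(hS T - hS t) / (2 T)]. The factored form shows the zeros at the endpoints and leaves the sign
    to the second factor. *)
Lemma flux_eq d r rho : 1 < r ->
  let t := hT r * (1 - rho) in
  two_lane_flux d (1 - d) r rho =
  (hS (hT r) - hS t) * (hS t + (2 * d - 1) * t) / (2 * hT r ^ 2).
Proof.
intros Hr t.
assert (HT := hT_pos r Hr); set (T := hT r) in *.
set (b := hS T); assert (Hb : 0 < b) by apply hS_pos.
assert (Eb : b ^ 2 = 1 + T ^ 2) by apply hS_sq.
assert (Hs : 0 < sqrt r) by (apply sqrt_lt_R0; lra).
assert (Ek : (r - 1) / (r + 1) = T / b).
{ unfold b, T; rewrite hS_hT by lra; unfold hT; field; lra. }
assert (Ek' : (r + 1) / (r - 1) = b / T).
{ unfold b, T; rewrite hS_hT by lra; unfold hT; field; lra. }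
assert (Ephi : phi r rho = (b - hS t) / (2 * T)).
{ unfold phi; destruct (Req_EM_T r 1); [lra|].
  assert (Epsi : sqrt (psi r rho) = hS t / b).
  { apply eq_of_sq_eq; [apply sqrt_pos | |].
    - apply Rlt_le, Rdiv_lt_0_compat; [apply hS_pos | easy].
    - replace ((hS t / b) ^ 2) with (hS t ^ 2 / b ^ 2) by (field; lra).
      rewrite hS_sq.
      assert (Ep : psi r rho = (1 + t ^ 2) / b ^ 2).
      { unfold psi; rewrite Ek.
        replace (1 + (T / b) ^ 2 * (rho * (rho - 2)))
          with ((b ^ 2 + T ^ 2 * (rho * (rho - 2))) / b ^ 2) by (field; lra).
        rewrite Eb; unfold t; field; nra. }
      rewrite Ep; apply sqrt_sq, Rlt_le, Rdiv_lt_0_compat; nra. }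
  rewrite Epsi, Ek'; field; lra. }
unfold two_lane_flux; rewrite Ephi.
assert (Et : rho = 1 - t / T) by (unfold t; field; lra).
rewrite Et.
assert (Es := hS_sq t); set (s := hS t) in *.
apply Rminus_diag_uniq.
(* The two sides differ by a multiple of [(s ^ 2 - t ^ 2) - (b ^ 2 - T ^ 2)], and both brackets
   equal 1. *)
match goal with |- ?E = 0 => replace E with ((T ^ 2 - b ^ 2 - t ^ 2 + s ^ 2) / (4 * T ^ 2)) by (field; lra) end.
rewrite Eb, Es; field; lra.
Qed.

Definition dflux (m r rho : R) : R :=
  let T := hT r in let t := T * (1 - rho) in let s := hS t in
  (2 * t + m * s + m * t ^ 2 / s - hS T * t / s - m * hS T) / (2 * T).

Definition ddflux (m r rho : R) : R :=
  let t := hT r * (1 - rho) in (hS (hT r) - hF m t) / (2 * hS t ^ 3).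

Lemma is_derive_flux d r rho : 1 < r ->
  is_derive (two_lane_flux d (1 - d) r) rho (dflux (2 * d - 1) r rho).
Proof.
intros Hr; assert (HT := hT_pos r Hr).
eapply is_derive_ext.
{ intros x; symmetry; apply (flux_eq d r x Hr). }
set (T := hT r) in *; unfold dflux; fold T.
set (t := T * (1 - rho)).
assert (Hs := hS_pos t); assert (Es := hS_sq t).
auto_derive.
{ repeat split; eexists; apply hS_derive. }
change (T * (1 + - rho)) with t.
replace (Derive (fun x => hS x) t) with (t / hS t)
  by (symmetry; apply is_derive_unique, hS_derive).
set (s := hS t) in *; set (m := 2 * d - 1).
field; lra.
Qed.

Lemma is_derive_dflux m r rho : 1 < r ->
  is_derive (dflux m r) rho (ddflux m r rho).
Proof.
intros Hr; assert (HT := hT_pos r Hr).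
unfold dflux, ddflux; set (T := hT r) in *; cbv zeta.
set (t := T * (1 - rho)).
assert (Hs := hS_pos t); assert (Es := hS_sq t).
auto_derive.
{ change (T * (1 + - rho)) with t.
  repeat split; try (eexists; apply hS_derive); lra. }
change (T * (1 + - rho)) with t.
replace (Derive (fun x => hS x) t) with (t / hS t)
  by (symmetry; apply is_derive_unique, hS_derive).
unfold hF; set (s := hS t) in *.
apply Rminus_diag_uniq.
match goal with |- ?E = 0 => replace E with
  ((hS T - 3 * m * t) * (s ^ 2 - t ^ 2 - 1) / (2 * s ^ 3))
  by (field; lra) end.
rewrite Es; field; lra.
Qed.

Lemma Derive2_flux d r rho : 1 < r ->
  Derive_n (two_lane_flux d (1 - d) r) 2 rho = ddflux (2 * d - 1) r rho.
Proof.
intros Hr; simpl.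
rewrite (Derive_ext _ (dflux (2 * d - 1) r)).
- now apply is_derive_unique, is_derive_dflux.
- intros t; now apply is_derive_unique, is_derive_flux.
Qed.

(** * Shape of [hF] and [hg] *)

Lemma hF_derive m t : is_derive (hF m) t (3 * (m * (1 + 2 * t ^ 2) + 2 * t * hS t)).
Proof.
unfold hF.
assert (Hs := hS_pos t); assert (Es := hS_sq t).
auto_derive.
{ repeat split; eexists; apply hS_derive. }
replace (Derive (fun x => hS x) t) with (t / hS t)
  by (symmetry; apply is_derive_unique, hS_derive).
field; lra.
Qed.

Definition hy (m : R) : R := sqrt (1 - m ^ 2).
(** At the critical point [cosh 2x = 1 / hy m], and [sinh x ^ 2 = (cosh 2x - 1) / 2] yields this
    expression. *)
Definition tau (m : R) : R := sqrt ((1 - hy m) / (2 * hy m)).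

Lemma hy_sq m : 0 <= m < 1 -> hy m ^ 2 = 1 - m ^ 2.
Proof. intros; apply sqrt_sq; nra. Qed.

Lemma hy_bounds m : 0 <= m < 1 -> 0 < hy m <= 1.
Proof.
intros Hm; assert (E := hy_sq m Hm).
assert (0 < hy m) by (apply sqrt_lt_R0; nra).
nra.
Qed.

Lemma tau_ge0 m : 0 <= tau m.
Proof. apply sqrt_pos. Qed.

Lemma tau_sq m : 0 <= m < 1 -> 2 * hy m * tau m ^ 2 = 1 - hy m.
Proof.
intros Hm; assert (Hy := hy_bounds m Hm).
unfold tau; rewrite sqrt_sq; [field; lra|].
apply Rle_mult_inv_pos; lra.
Qed.

Lemma double_sq t : (2 * t * hS t) ^ 2 = (1 + 2 * t ^ 2) ^ 2 - 1.
Proof. rewrite !Rpow_mult_distr, hS_sq; ring. Qed.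

(** With [u = 1 + 2 t ^ 2], squaring turns [m u < - 2 t hS t] into [1 < (hy m * u) ^ 2] by
    [double_sq], and [hy m * u] equals 1 exactly at [t ^ 2 = tau m ^ 2]. *)
Lemma hF_decreasing m : 0 <= m < 1 ->
  forall x y, x < y -> y <= - tau m -> hF m y < hF m x.
Proof.
intros Hm x y Hxy Hy.
apply (decreasing_of_derive _ _ x y (hF_derive m)); try lra.
intros t Ht.
assert (Hb := hy_bounds m Hm); assert (Ey := hy_sq m Hm).
assert (Et := tau_sq m Hm); assert (H0 := tau_ge0 m).
assert (Hs := hS_pos t); assert (Ed := double_sq t).
assert (Hw : 1 < hy m * (1 + 2 * t ^ 2)).
{ assert (tau m ^ 2 < t ^ 2) by nra; nra. }
assert (m * (1 + 2 * t ^ 2) < - (2 * t * hS t)); [| lra].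
apply lt_of_sq_lt; [nra|].
replace ((- (2 * t * hS t)) ^ 2) with ((2 * t * hS t) ^ 2) by ring.
rewrite Ed, Rpow_mult_distr.
replace (m ^ 2) with (1 - hy m ^ 2) by lra.
set (u := 1 + 2 * t ^ 2) in *.
assert (1 < (hy m * u) ^ 2) by nra.
replace ((hy m * u) ^ 2) with (hy m ^ 2 * u ^ 2) in * by ring.
lra.
Qed.

Lemma hF_increasing m : 0 <= m < 1 ->
  forall x y, - tau m <= x -> x < y -> hF m x < hF m y.
Proof.
intros Hm x y Hx Hxy.
assert (Hb := hy_bounds m Hm); assert (Ey := hy_sq m Hm).
assert (Et := tau_sq m Hm); assert (H0 := tau_ge0 m).
assert (Hpos : forall t, - tau m < t -> t <> 0 -> 0 < m * (1 + 2 * t ^ 2) + 2 * t * hS t).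
{ intros t Ht Hne; assert (Hs := hS_pos t).
  destruct (Rlt_le_dec 0 t) as [Hp | Hn].
  { assert (0 < 2 * t * hS t) by (apply Rmult_lt_0_compat; lra).
    nra. }
  assert (Ed := double_sq t).
  assert (Hw : hy m * (1 + 2 * t ^ 2) < 1).
  { assert (t ^ 2 < tau m ^ 2) by nra; nra. }
  assert (- (2 * t * hS t) < m * (1 + 2 * t ^ 2)); [| lra].
  apply lt_of_sq_lt; [nra|].
  replace ((- (2 * t * hS t)) ^ 2) with ((2 * t * hS t) ^ 2) by ring.
  rewrite Ed, Rpow_mult_distr.
  replace (m ^ 2) with (1 - hy m ^ 2) by lra.
  assert (1 <= 1 + 2 * t ^ 2) by nra.
  set (u := 1 + 2 * t ^ 2) in *.
  assert ((hy m * u) ^ 2 < 1).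
  { assert (0 < hy m * u) by (apply Rmult_lt_0_compat; lra). nra. }
  replace ((hy m * u) ^ 2) with (hy m ^ 2 * u ^ 2) in * by ring.
  lra. }
assert (Hoff : forall a b, - tau m <= a -> a < b -> ~ a < 0 < b -> hF m a < hF m b).
{ intros a b Ha Hab Hz.
  apply (increasing_of_derive _ _ a b (hF_derive m)); try lra.
  intros t Ht; apply Rmult_lt_0_compat; [lra | apply Hpos; lra]. }
destruct (Rlt_dec x 0); [destruct (Rlt_dec 0 y) |].
- apply Rlt_trans with (hF m 0); apply Hoff; lra.
- apply Hoff; lra.
- apply Hoff; lra.
Qed.

Lemma hF_increasing_ge1 m : 1 <= m -> forall x y, x < y -> hF m x < hF m y.
Proof.
intros Hm x y Hxy.
apply (increasing_of_derive _ _ x y (hF_derive m)); try lra.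
intros t _.
assert (Hs := hS_pos t); assert (Ed := double_sq t).
assert (- (2 * t * hS t) < 1 + 2 * t ^ 2).
{ apply lt_of_sq_lt; [nra|].
  replace ((- (2 * t * hS t)) ^ 2) with ((2 * t * hS t) ^ 2) by ring.
  rewrite Ed; lra. }
nra.
Qed.

Lemma hF_quasiconvex m : 0 <= m -> strictly_quasiconvex_on (fun _ => True) (hF m).
Proof.
intros Hm x y z _ _ Hy.
destruct (Rlt_le_dec m 1) as [H1 | H1].
- destruct (Rle_dec y (- tau m)).
  + left; apply hF_decreasing; lra.
  + right; apply hF_increasing; lra.
- right; apply hF_increasing_ge1; lra.
Qed.

(** The point [t = T] is [rho = 0], so this says that the flux always starts out concave. It follows
    from [2 hS T ^ 3 > hS T]. *)
Lemma hF_gt_hS m T : 0 <= m -> 0 <= T -> hS T < hF m T.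
Proof.
intros Hm HT; unfold hF; assert (Hs := hS_ge1 T).
assert (0 <= m * (3 * T + 2 * T ^ 3)).
{ apply Rmult_le_pos; [easy|]; assert (0 <= T ^ 3) by now apply pow_le. lra. }
assert (hS T < 2 * hS T ^ 3); [| lra].
assert (1 <= hS T ^ 2) by nra.
replace (2 * hS T ^ 3) with (2 * hS T ^ 2 * hS T) by ring.
nra.
Qed.

Lemma hF_min m : 0 <= m < 1 -> hF m (- tau m) = 2 * hy m * hS (tau m).
Proof.
intros Hm; assert (Hb := hy_bounds m Hm); assert (Ey := hy_sq m Hm).
assert (Et := tau_sq m Hm); assert (H0 := tau_ge0 m).
assert (Hs := hS_pos (tau m)); assert (Es := hS_sq (tau m)).
(* The half-angle formula for [tanh] at the critical point, checked on squares; it removes [m] from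
   the minimum. *)
assert (Emt : m * tau m = (1 - hy m) * hS (tau m)).
{ apply eq_of_sq_eq; [nra | nra |].
  rewrite !Rpow_mult_distr, Es.
  replace (m ^ 2) with (1 - hy m ^ 2) by lra.
  replace (tau m ^ 2) with ((1 - hy m) / (2 * hy m)) by (rewrite <- Et; field; lra).
  field; lra. }
unfold hF; rewrite hS_opp.
replace (m * (3 * - tau m + 2 * (- tau m) ^ 3)) with (- (m * tau m) * (3 + 2 * tau m ^ 2)) by ring.
rewrite Emt.
replace (2 * hS (tau m) ^ 3) with (2 * hS (tau m) ^ 2 * hS (tau m)) by ring.
rewrite Es.
replace (tau m ^ 2) with ((1 - hy m) / (2 * hy m)) by (rewrite <- Et; field; lra).
field; lra.
Qed.

(* [hg r = 2 d - 1] is the condition [G'' 2 = 0]. *)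
Definition hg (r : R) : R := (r + 1) * (r ^ 2 + 1) / ((r - 1) * (r ^ 2 + 4 * r + 1)).

Lemma hF_boundary m r : 1 < r ->
  exists c, 0 < c /\ hF m (- hT r) - hS (hT r) = c * (hg r - m).
Proof.
intros Hr.
assert (Hs : 0 < sqrt r) by (apply sqrt_lt_R0; lra).
assert (Er : sqrt r ^ 2 = r) by (apply sqrt_sq; lra).
exists ((r - 1) * (r ^ 2 + 4 * r + 1) / (4 * sqrt r ^ 3)); split.
{ apply Rdiv_lt_0_compat.
  - apply Rmult_lt_0_compat; nra.
  - assert (0 < sqrt r ^ 3) by now apply pow_lt. lra. }
unfold hF; rewrite hS_opp, hS_hT by lra; unfold hT, hg.
set (q := sqrt r) in *; rewrite <- Er in Hr |- *; clearbody q.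
field; repeat split; nra.
Qed.

(** * The valley shape of [hg] and its lowest point *)

Definition hc (r : R) : R := (r + 1 / r) / 2.
(** The larger root of [r + 1 / r = 2 (1 + sqrt 3)], that is [c + sqrt (c ^ 2 - 1)] for
    [c = 1 + sqrt 3]. *)
Definition rs : R := 1 + sqrt 3 + sqrt (3 + 2 * sqrt 3).

Lemma sqrt3_bounds : 1.73 < sqrt 3 < 1.74.
Proof.
split.
- apply lt_of_sq_lt; [apply sqrt_pos | rewrite sqrt_sq; lra].
- apply lt_of_sq_lt; [lra | rewrite sqrt_sq; lra].
Qed.

Lemma hc_lt x y : 1 <= x < y -> hc x < hc y.
Proof.
intros H; unfold hc.
assert (E : (y + 1 / y) / 2 - (x + 1 / x) / 2 = (y - x) * (x * y - 1) / (2 * (x * y)))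
  by (field; lra).
assert (0 < (y - x) * (x * y - 1) / (2 * (x * y))); [| lra].
apply Rdiv_lt_0_compat; [apply Rmult_lt_0_compat; nra | nra].
Qed.

Lemma hc_gt1 r : 1 < r -> 1 < hc r.
Proof.
intros Hr; generalize (hc_lt 1 r (conj (Rle_refl 1) Hr)); unfold hc; lra.
Qed.

Lemma rs_gt : 5 < rs.
Proof.
assert (H := sqrt3_bounds); unfold rs.
assert (2.5 < sqrt (3 + 2 * sqrt 3)); [| lra].
apply lt_of_sq_lt; [apply sqrt_pos | rewrite sqrt_sq; lra].
Qed.

Lemma hc_rs : hc rs = 1 + sqrt 3.
Proof.
assert (H := rs_gt); assert (H3 := sqrt3_bounds).
unfold hc; apply Rmult_eq_reg_r with (2 * rs); [| lra].
replace ((rs + 1 / rs) / 2 * (2 * rs)) with (rs ^ 2 + 1) by (field; lra).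
unfold rs.
assert (E := sqrt_sq (3 + 2 * sqrt 3) ltac:(lra)).
assert (E3 := sqrt_sq 3 ltac:(lra)).
nra.
Qed.

(** [hg] squared is a function of [c = cosh (ln r)] only: [((r + 1) / (r - 1)) ^ 2 = (c + 1) / (c -
    1)] and [(r ^ 2 + 1) / (r ^ 2 + 4 r + 1) = c / (c + 2)]. *)
Definition hh (c : R) : R := (c + 1) * c ^ 2 / ((c - 1) * (c + 2) ^ 2).

Lemma hg_sq r : 1 < r -> hg r ^ 2 = hh (hc r).
Proof. intros Hr; unfold hg, hh, hc; field; repeat split; nra. Qed.

Lemma hg_pos r : 1 < r -> 0 < hg r.
Proof.
intros; unfold hg; apply Rdiv_lt_0_compat; apply Rmult_lt_0_compat; nra.
Qed.

(** This replaces a derivative: for [c = e] the last factor is [c (c + 2) (c ^ 2 - 2 c - 2)], so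
    monotonicity turns at [c = 1 + sqrt 3]. *)
Lemma hh_sub c e : 1 < c -> 1 < e ->
  exists k, 0 < k /\ hh e - hh c =
    k * (e - c) * (c ^ 2 * e ^ 2 - 2 * (c ^ 2 + c * e + e ^ 2) - 2 * (c + e)).
Proof.
intros Hc He.
exists (2 / ((c - 1) * (c + 2) ^ 2 * ((e - 1) * (e + 2) ^ 2))); split.
- apply Rdiv_lt_0_compat; [lra|].
  repeat apply Rmult_lt_0_compat; nra.
- unfold hh; field; lra.
Qed.

Lemma hg_decreasing x y : 1 < x -> x < y -> y <= rs -> hg y < hg x.
Proof.
intros Hx Hxy Hy.
apply lt_of_sq_lt; [apply Rlt_le, hg_pos; lra|].
rewrite !hg_sq by lra.
assert (Hc := hc_gt1 x Hx); assert (Hce := hc_lt x y ltac:(lra)).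
assert (He : hc y <= 1 + sqrt 3).
{ rewrite <- hc_rs; destruct Hy as [Hy | ->]; [apply Rlt_le, hc_lt; lra | lra]. }
set (c := hc x) in *; set (e := hc y) in *.
destruct (hh_sub c e Hc ltac:(lra)) as [k [Hk E]].
assert (H3 := sqrt3_bounds); assert (E3 := sqrt_sq 3 ltac:(lra)).
assert (He2 : e ^ 2 <= 2 * e + 2) by nra.
assert (Hc2 : c ^ 2 <= 2 * c + 2) by nra.
(* The two estimates below bound the left side by [2 (e - c) (1 - e)]. *)
assert (c ^ 2 * e ^ 2 - 2 * (c ^ 2 + c * e + e ^ 2) - 2 * (c + e) < 0).
{ assert (c ^ 2 * e ^ 2 <= c ^ 2 * (2 * e + 2)) by (apply Rmult_le_compat_l; nra).
  assert (e * c ^ 2 <= e * (2 * c + 2)) by (apply Rmult_le_compat_l; nra).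
  nra. }
assert (0 < k * (e - c)) by (apply Rmult_lt_0_compat; lra).
nra.
Qed.

Lemma hg_increasing x y : rs <= x -> x < y -> hg x < hg y.
Proof.
intros Hx Hxy; assert (Hrs := rs_gt).
apply lt_of_sq_lt; [apply Rlt_le, hg_pos; lra|].
rewrite !hg_sq by lra.
assert (Hce := hc_lt x y ltac:(lra)).
assert (Hc : 1 + sqrt 3 <= hc x).
{ rewrite <- hc_rs; destruct Hx as [Hx | ->]; [apply Rlt_le, hc_lt; lra | lra]. }
set (c := hc x) in *; set (e := hc y) in *.
assert (H3 := sqrt3_bounds); assert (E3 := sqrt_sq 3 ltac:(lra)).
destruct (hh_sub c e ltac:(lra) ltac:(lra)) as [k [Hk E]].
assert (He2 : 2 * e + 2 < e ^ 2) by nra.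
assert (Hc2 : 2 * c + 2 <= c ^ 2) by nra.
assert (0 < c ^ 2 * e ^ 2 - 2 * (c ^ 2 + c * e + e ^ 2) - 2 * (c + e)).
{ assert (c ^ 2 * (2 * e + 2) < c ^ 2 * e ^ 2) by (apply Rmult_lt_compat_l; nra).
  assert (e * (2 * c + 2) <= e * c ^ 2) by (apply Rmult_le_compat_l; nra).
  nra. }
assert (0 < k * (e - c)) by (apply Rmult_lt_0_compat; lra).
nra.
Qed.

Lemma hg_rs : hg rs = sqrt (3 + 2 * sqrt 3) / 3.
Proof.
assert (Hrs := rs_gt); assert (H3 := sqrt3_bounds); assert (E3 := sqrt_sq 3 ltac:(lra)).
apply eq_of_sq_eq.
- apply Rlt_le, hg_pos; lra.
- apply Rle_mult_inv_pos; [apply sqrt_pos | lra].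
- rewrite hg_sq, hc_rs by lra.
  replace ((sqrt (3 + 2 * sqrt 3) / 3) ^ 2) with (sqrt (3 + 2 * sqrt 3) ^ 2 / 9) by field.
  rewrite sqrt_sq by lra.
  unfold hh.
  set (q := sqrt 3) in *; clearbody q.
  apply Rmult_eq_reg_r with (9 * (q * (q + 3) ^ 2)); [| nra].
  replace ((1 + q + 1) * (1 + q) ^ 2 / ((1 + q - 1) * (1 + q + 2) ^ 2) * (9 * (q * (q + 3) ^ 2)))
    with (9 * ((2 + q) * (1 + q) ^ 2)) by (field; lra).
  replace ((3 + 2 * q) / 9 * (9 * (q * (q + 3) ^ 2))) with ((3 + 2 * q) * (q * (q + 3) ^ 2)) by field.
  assert (E : q ^ 3 = 3 * q) by (replace (q ^ 3) with (q ^ 2 * q) by ring; rewrite E3; ring).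
  assert (E4 : q ^ 4 = 9) by (replace (q ^ 4) with ((q ^ 2) ^ 2) by ring; rewrite E3; ring).
  nra.
Qed.

Lemma hg_ge r : 1 < r -> hg rs <= hg r.
Proof.
intros Hr; destruct (Rtotal_order r rs) as [H | [-> | H]].
- apply Rlt_le, hg_decreasing; lra.
- lra.
- apply Rlt_le, hg_increasing; lra.
Qed.

(** * Counting inflexion points *)

Lemma ddflux_pos m r rho :
  hF m (hT r * (1 - rho)) < hS (hT r) -> 0 < ddflux m r rho.
Proof.
intros H; unfold ddflux; apply Rdiv_lt_0_compat; [lra|].
generalize (pow_lt _ 3 (hS_pos (hT r * (1 - rho)))); lra.
Qed.

Lemma ddflux_neg m r rho :
  hS (hT r) < hF m (hT r * (1 - rho)) -> ddflux m r rho < 0.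
Proof.
intros H; unfold ddflux.
rewrite <- (Ropp_involutive (hS (hT r) - _)), Rdiv_opp_l.
apply Ropp_lt_gt_0_contravar; apply Rdiv_lt_0_compat; [lra|].
generalize (pow_lt _ 3 (hS_pos (hT r * (1 - rho)))); lra.
Qed.

Lemma flux_concave_of_hF d r t0 : 1 < r ->
  (forall t, - hT r < t < hT r -> t <> t0 -> hS (hT r) < hF (2 * d - 1) t) ->
  strictly_concave (two_lane_flux d (1 - d) r).
Proof.
intros Hr HF; assert (HT := hT_pos r Hr).
apply (strictly_concave_of_derive2 _ (dflux (2 * d - 1) r) (ddflux (2 * d - 1) r)
  (1 - t0 / hT r)).
- intros x; now apply is_derive_flux.
- intros x; now apply is_derive_dflux.
- intros x Hx Hne; apply ddflux_neg, HF; [nra|].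
  intros E; apply Hne; rewrite <- E; field; lra.
Qed.

Lemma hF_root m p q v : p < q ->
  (hF m p < v < hF m q \/ hF m q < v < hF m p) -> exists t, p < t < q /\ hF m t = v.
Proof.
intros Hpq H.
assert (Hc : continuity (fun t => hF m t - v)).
{ intros t; apply continuity_pt_minus; [| apply continuity_pt_const; now intros ? ?].
  apply derivable_continuous_pt.
  eexists; apply is_derive_Reals, hF_derive. }
destruct (IVT_cor _ p q Hc (Rlt_le _ _ Hpq)) as [t [Ht E]]; [nra|].
exists t; split; [| lra].
split.
- destruct (Req_dec t p) as [-> | ]; lra.
- destruct (Req_dec t q) as [-> | ]; lra.
Qed.

(** The endpoint inequality is not strict: at [r = r3 d] and [r = r4 d] the second derivative may
    vanish at [rho = 2], outside the open interval. The point [p] then provides a value strictly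
    below the level for the intermediate value theorem. By quasi-convexity the root [t0] is the only
    one inside, since the left endpoint is not above the level. *)
Lemma flux_single_sign m r p : 1 < r -> 0 <= m ->
  hF m (- hT r) <= hS (hT r) -> - hT r <= p < hT r -> hF m p < hS (hT r) ->
  exists x0, 0 < x0 < 2 /\ (forall x, 0 < x < x0 -> ddflux m r x < 0) /\
    (forall x, x0 < x < 2 -> 0 < ddflux m r x).
Proof.
intros Hr Hm Hl Hp HFp; assert (HT := hT_pos r Hr).
assert (Hright := hF_gt_hS m (hT r) Hm (Rlt_le _ _ HT)).
destruct (hF_root m p (hT r) (hS (hT r))) as [t0 [Ht0 E0]]; [lra | lra |].
assert (Hq := hF_quasiconvex m Hm).
set (T := hT r) in *.
exists (1 - t0 / T).
assert (Ex : forall x, T * (1 - x) - t0 = T * (1 - t0 / T - x)) by (intros; field; lra).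
assert (H0 : 0 < 1 - t0 / T < 2).
{ generalize (Ex 0) (Ex 2); nra. }
split; [easy | split]; intros x Hx; generalize (Ex x); intros Ex'.
- apply ddflux_neg; fold T.
  destruct (Hq (- T) t0 (T * (1 - x))) as [H | H]; auto; [nra | lra | lra].
- apply ddflux_pos; fold T.
  destruct (Hq (- T) (T * (1 - x)) t0) as [H | H]; auto; [nra | lra | lra].
Qed.

Lemma flux_single_of_hF d r p : 1 < r -> 1 / 2 <= d ->
  hF (2 * d - 1) (- hT r) <= hS (hT r) ->
  - hT r <= p < hT r -> hF (2 * d - 1) p < hS (hT r) ->
  single_inflexion_point (two_lane_flux d (1 - d) r).
Proof.
intros Hr Hd Hl Hp HFp.
destruct (flux_single_sign (2 * d - 1) r p Hr ltac:(lra) Hl Hp HFp) as [x0 [H0 [Hn Hpos]]].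
apply (single_inflexion_of_sign _ x0 H0); intros x Hx; rewrite Derive2_flux; auto.
Qed.

(** Both endpoints lie above the level and [p] below it, which gives a root on each side of [p];
    quasi-convexity fixes the signs between and outside them. *)
Lemma flux_two_of_hF d r p : 1 < r -> 1 / 2 <= d ->
  hS (hT r) < hF (2 * d - 1) (- hT r) ->
  - hT r < p < hT r -> hF (2 * d - 1) p < hS (hT r) ->
  two_inflexion_points (two_lane_flux d (1 - d) r).
Proof.
intros Hr Hd Hl Hp HFp; assert (HT := hT_pos r Hr).
assert (Hm : 0 <= 2 * d - 1) by lra; set (m := 2 * d - 1) in *.
assert (Hright := hF_gt_hS m (hT r) Hm (Rlt_le _ _ HT)).
destruct (hF_root m (- hT r) p (hS (hT r))) as [t1 [Ht1 E1]]; [lra | lra |].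
destruct (hF_root m p (hT r) (hS (hT r))) as [t2 [Ht2 E2]]; [lra | lra |].
assert (Hq := hF_quasiconvex m Hm).
set (T := hT r) in *.
assert (Ex1 : forall x, T * (1 - x) - t1 = T * (1 - t1 / T - x)) by (intros; field; lra).
assert (Ex2 : forall x, T * (1 - x) - t2 = T * (1 - t2 / T - x)) by (intros; field; lra).
apply (two_inflexions_of_sign _ (1 - t2 / T) (1 - t1 / T)).
- generalize (Ex2 0) (Ex2 (1 - t1 / T)) (Ex1 (1 - t1 / T)); nra.
- generalize (Ex1 2); nra.
- intros x Hx; rewrite Derive2_flux by easy; apply ddflux_neg; fold T m.
  generalize (Ex2 x); intros Ex'.
  destruct (Hq p t2 (T * (1 - x))) as [H | H]; auto; [nra | lra | lra].
- intros x Hx; rewrite Derive2_flux by easy; apply ddflux_pos; fold T m.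
  generalize (Ex2 x) (Ex1 x); intros Ex' Ex''.
  destruct (Hq t1 (T * (1 - x)) t2) as [H | H]; auto; [nra | lra | lra].
- intros x Hx; rewrite Derive2_flux by easy; apply ddflux_neg; fold T m.
  generalize (Ex1 x); intros Ex'.
  destruct (Hq (T * (1 - x)) t1 p) as [H | H]; auto; [nra | lra | lra].
Qed.

Lemma hF_boundary_gt m r : 1 < r -> m < hg r <-> hS (hT r) < hF m (- hT r).
Proof. intros Hr; destruct (hF_boundary m r Hr) as [c [Hc E]]; split; nra. Qed.

Lemma hF_boundary_lt m r : 1 < r -> hg r < m <-> hF m (- hT r) < hS (hT r).
Proof. intros Hr; destruct (hF_boundary m r Hr) as [c [Hc E]]; split; nra. Qed.

Lemma flux_concave_r1 d : strictly_concave (two_lane_flux d (1 - d) 1).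
Proof.
intros x y t Hx Hy Hne Ht; unfold two_lane_flux, phi.
destruct (Req_EM_T 1 1) as [_ | H]; [| now elim H].
assert (0 < t * (1 - t) * (x - y) ^ 2).
{ apply Rmult_lt_0_compat; [nra|]; nra. }
nra.
Qed.

(** Under equality [hF] touches the level at [- tau], which is taken as the exceptional point. *)
Lemma flux_concave_below_min d r : 1 < r -> 1 / 2 <= d < 1 ->
  hS (hT r) <= hF (2 * d - 1) (- tau (2 * d - 1)) ->
  strictly_concave (two_lane_flux d (1 - d) r).
Proof.
intros Hr Hd Hmin.
apply (flux_concave_of_hF d r (- tau (2 * d - 1)) Hr).
intros t _ Hne.
apply Rle_lt_trans with (1 := Hmin).
destruct (Rlt_le_dec t (- tau (2 * d - 1))).
- apply hF_decreasing; lra.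
- apply hF_increasing; lra.
Qed.

(** For [T <= tau], or for [d >= 1], [hF] increases on all of [[- T, T]], so its lowest value is the
    endpoint value governed by [hg]. *)
Lemma flux_concave_boundary d r : 1 < r -> 1 / 2 <= d ->
  (d < 1 -> hT r <= tau (2 * d - 1)) -> 2 * d - 1 <= hg r ->
  strictly_concave (two_lane_flux d (1 - d) r).
Proof.
intros Hr Hd Htau Hg.
(* The strict inequality holds at every inner [t], so the exceptional point 0 is an arbitrary
   choice. *)
apply (flux_concave_of_hF d r 0 Hr).
intros t Ht _.
assert (hS (hT r) <= hF (2 * d - 1) (- hT r)).
{ destruct (Rle_lt_dec (hS (hT r)) (hF (2 * d - 1) (- hT r))) as [|H]; [easy|].
  apply (hF_boundary_lt _ r Hr) in H; lra. }
apply Rle_lt_trans with (1 := H).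
destruct (Rlt_le_dec d 1) as [H1 | H1].
- specialize (Htau H1); apply hF_increasing; lra.
- apply hF_increasing_ge1; lra.
Qed.

(** * The threshold functions *)

(** Solving [hg r = 2 d - 1] means solving a cubic, so the root on each branch is picked by
    [epsilon]; monotonicity makes it unique. Outside the intended domain the value is
    unspecified. *)
Definition r3 (d : R) : R :=
  epsilon (inhabits 0) (fun r => 1 < r <= rs /\ hg r = 2 * d - 1).
Definition r4 (d : R) : R :=
  epsilon (inhabits 0) (fun r => rs <= r /\ hg r = 2 * d - 1).
(** The [T] under [hR] solves [1 + T ^ 2 = 2 y + 2 y ^ 2] with [y = hy (2 d - 1)]: [hS T] equals the
    minimum of [hF]. Beyond [d1_bar] the radicand is negative, [sqrt] returns 0, and the value is
    1. *)
Definition r1_bar (d : R) : R :=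
  hR (sqrt (2 * hy (2 * d - 1) + 2 * hy (2 * d - 1) ^ 2 - 1)).

Lemma hg_rs_d1 : hg rs = 2 * d1_tilde - 1.
Proof. rewrite hg_rs; unfold d1_tilde; lra. Qed.

(** The equation [hg r = m] with denominators cleared: a polynomial, so the intermediate value
    theorem can start at [r = 1], where [hg] has a pole. *)
Definition hgap (m r : R) : R := (r + 1) * (r ^ 2 + 1) - m * ((r - 1) * (r ^ 2 + 4 * r + 1)).

Lemma hgap_hg m r : 1 < r -> hgap m r = (r - 1) * (r ^ 2 + 4 * r + 1) * (hg r - m).
Proof. intros; unfold hgap, hg; field; nra. Qed.

Lemma hg_eq_of_hgap m r : 1 < r -> hgap m r = 0 -> hg r = m.
Proof.
intros Hr H; rewrite hgap_hg in H by easy.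
apply Rmult_integral in H; destruct H as [H | H]; [exfalso | lra].
assert (0 < (r - 1) * (r ^ 2 + 4 * r + 1)) by (apply Rmult_lt_0_compat; nra); lra.
Qed.

Lemma hgap_continuity m : continuity (hgap m).
Proof. unfold hgap; reg. Qed.

Lemma r3_spec d : d1_tilde <= d -> 1 < r3 d <= rs /\ hg (r3 d) = 2 * d - 1.
Proof.
intros Hd; unfold r3; apply epsilon_spec.
assert (Hrs := rs_gt); assert (Em := hg_rs_d1).
set (m := 2 * d - 1).
assert (H1 : hgap m 1 = 4) by (unfold hgap; ring).
assert (H2 : hgap m rs <= 0).
{ rewrite hgap_hg by lra.
  assert (0 < (rs - 1) * (rs ^ 2 + 4 * rs + 1)) by (apply Rmult_lt_0_compat; nra).
  unfold m; nra. }
destruct (IVT_cor (hgap m) 1 rs (hgap_continuity m)) as [r [Hr E]]; [lra | nra |].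
assert (r <> 1) by (intros ->; lra).
exists r; split; [lra|]; apply hg_eq_of_hgap; lra.
Qed.

Lemma r4_spec d : d1_tilde <= d < 1 -> rs <= r4 d /\ hg (r4 d) = 2 * d - 1.
Proof.
intros Hd; unfold r4; apply epsilon_spec.
assert (Hrs := rs_gt); assert (Em := hg_rs_d1).
assert (Hp := hg_pos rs ltac:(lra)).
set (m := 2 * d - 1).
assert (H2 : hgap m rs <= 0).
{ rewrite hgap_hg by lra.
  assert (0 < (rs - 1) * (rs ^ 2 + 4 * rs + 1)) by (apply Rmult_lt_0_compat; nra).
  unfold m; nra. }
(* Chosen so that [(1 - m) M >= 2]; the coefficient [(1 - m) M + 1 - 3 m] of [M ^ 2] in [hgap m M]
   is then at least [3 (1 - m)]. *)
set (M := Rmax rs (2 / (1 - m))).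
assert (HM1 : rs <= M) by apply Rmax_l.
assert (HM2 : 2 <= (1 - m) * M).
{ replace 2 with ((1 - m) * (2 / (1 - m))) by (field; unfold m; lra).
  apply Rmult_le_compat_l; [unfold m; lra | apply Rmax_r]. }
assert (HM : 0 < hgap m M).
{ replace (hgap m M) with (M ^ 2 * ((1 - m) * M + 1 - 3 * m) + (1 + 3 * m) * M + (1 + m))
    by (unfold hgap; ring).
  assert (0 <= M ^ 2 * ((1 - m) * M + 1 - 3 * m)) by (apply Rmult_le_pos; unfold m in *; nra).
  assert (0 < (1 + 3 * m) * M) by (apply Rmult_lt_0_compat; unfold m in *; nra).
  unfold m in *; lra. }
destruct (IVT_cor (hgap m) rs M (hgap_continuity m)) as [r [Hr E]]; [lra | nra |].
exists r; split; [lra|]; apply hg_eq_of_hgap; lra.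
Qed.

(** Denominator minus numerator is [2 (r ^ 2 - 2 r - 1)], whose positive root is [1 + sqrt 2]. *)
Lemma hg_lt1 r : 1 + sqrt 2 < r -> hg r < 1.
Proof.
intros Hr.
assert (H2 := sqrt_sq 2 ltac:(lra)); assert (H0 := sqrt_pos 2).
assert (0 < (r - 1) * (r ^ 2 + 4 * r + 1)) by (apply Rmult_lt_0_compat; nra).
unfold hg; apply Rmult_lt_reg_r with ((r - 1) * (r ^ 2 + 4 * r + 1)); [easy|].
replace ((r + 1) * (r ^ 2 + 1) / ((r - 1) * (r ^ 2 + 4 * r + 1)) * ((r - 1) * (r ^ 2 + 4 * r + 1)))
  with ((r + 1) * (r ^ 2 + 1)) by (field; nra).
nra.
Qed.

Lemma sqrt2_bounds : 1 < sqrt 2 < 2.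
Proof.
split; apply lt_of_sq_lt; try rewrite sqrt_sq; try lra; apply sqrt_pos.
Qed.

Lemma hg_below_r3 d r : d1_tilde <= d -> 1 < r < r3 d -> 2 * d - 1 < hg r.
Proof.
intros Hd Hr; destruct (r3_spec d Hd) as [H1 <-]; apply hg_decreasing; lra.
Qed.

Lemma hg_between d r : d1_tilde <= d < 1 -> r3 d < r < r4 d -> hg r < 2 * d - 1.
Proof.
intros Hd Hr; destruct (r3_spec d) as [H1 E1]; [lra|].
destruct (r4_spec d Hd) as [H2 E2].
destruct (Rle_dec r rs).
- rewrite <- E1; apply hg_decreasing; lra.
- rewrite <- E2; apply hg_increasing; lra.
Qed.

Lemma hg_above_r4 d r : d1_tilde <= d < 1 -> r4 d < r -> 2 * d - 1 < hg r.
Proof.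
intros Hd Hr; destruct (r4_spec d Hd) as [H2 <-]; apply hg_increasing; lra.
Qed.

(** For [d >= 1] there is no second crossing: past [rs] the function [hg] stays below
    [1 <= 2 d - 1]. *)
Lemma hg_above_r3 d r : d1_tilde <= d -> 1 <= d -> r3 d < r -> hg r < 2 * d - 1.
Proof.
intros Hd Hd1 Hr; destruct (r3_spec d Hd) as [H1 E1].
destruct (Rle_dec r rs).
- rewrite <- E1; apply hg_decreasing; lra.
- assert (hg r < 1); [| lra].
  apply hg_lt1; generalize sqrt2_bounds rs_gt; lra.
Qed.

Lemma hg_decreasing_drift : decreasing_on (fun r => 1 < r <= rs) (fun r => (1 + hg r) / 2).
Proof.
intros x y Hx Hy Hxy.
generalize (hg_decreasing x y ltac:(lra) Hxy ltac:(lra)); lra.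
Qed.

Lemma hg_increasing_drift : increasing_on (fun r => rs <= r) (fun r => (1 + hg r) / 2).
Proof.
intros x y Hx Hy Hxy; generalize (hg_increasing x y Hx Hxy); lra.
Qed.

Lemma r3_continuous : continuous_on (fun d => d1_tilde <= d) r3.
Proof.
apply (continuous_on_left_inverse_decreasing _ (fun r => 1 < r <= rs) (fun r => (1 + hg r) / 2)).
- intros; lra.
- apply hg_decreasing_drift.
- intros d Hd; destruct (r3_spec d Hd) as [H E]; rewrite E; split; [easy | lra].
Qed.

Lemma r4_continuous : continuous_on (fun d => d1_tilde <= d < 1) r4.
Proof.
apply (continuous_on_left_inverse_increasing _ (fun r => rs <= r) (fun r => (1 + hg r) / 2)).
- intros; lra.
- apply hg_increasing_drift.
- intros d Hd; destruct (r4_spec d Hd) as [H E]; rewrite E; split; [easy | lra].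
Qed.

Lemma r3_decreasing : decreasing_on (fun d => d1_tilde <= d) r3.
Proof.
intros x y Hx Hy Hxy.
destruct (r3_spec x Hx) as [H1 E1]; destruct (r3_spec y Hy) as [H2 E2].
destruct (Rlt_le_dec (r3 y) (r3 x)) as [|Hle]; [easy | exfalso].
destruct Hle as [Hlt | E]; [| rewrite E in E1; lra].
generalize (hg_decreasing (r3 x) (r3 y) ltac:(lra) Hlt ltac:(lra)); lra.
Qed.

Lemma r4_increasing : increasing_on (fun d => d1_tilde <= d < 1) r4.
Proof.
intros x y Hx Hy Hxy.
destruct (r4_spec x Hx) as [H1 E1]; destruct (r4_spec y Hy) as [H2 E2].
destruct (Rlt_le_dec (r4 x) (r4 y)) as [|Hle]; [easy | exfalso].
destruct Hle as [Hlt | E]; [| rewrite E in E2; lra].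
generalize (hg_increasing (r4 y) (r4 x) ltac:(lra) Hlt); lra.
Qed.

Lemma sqrt_3_2sqrt3 : sqrt (3 + 2 * sqrt 3) ^ 2 = 3 + 2 * sqrt 3.
Proof. apply sqrt_sq; generalize sqrt3_bounds; lra. Qed.

Lemma d1_tilde_bounds : 1 / 2 < d1_tilde /\ 0.92 < d1_tilde < 0.93.
Proof.
assert (H3 := sqrt3_bounds).
assert (E := sqrt_3_2sqrt3).
assert (H : 2.54 < sqrt (3 + 2 * sqrt 3)).
{ apply lt_of_sq_lt; [apply sqrt_pos | lra]. }
assert (H' : sqrt (3 + 2 * sqrt 3) < 2.546).
{ apply lt_of_sq_lt; [lra | rewrite E; lra]. }
unfold d1_tilde; lra.
Qed.

Lemma d0_tilde_bounds : 0.932 < d0_tilde < 0.9351.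
Proof. unfold d0_tilde; generalize sqrt3_bounds; lra. Qed.

Lemma d1_bar_bounds : 0.9625 < d1_bar < 1.
Proof.
assert (H3 := sqrt3_bounds).
assert (E := sqrt_sq (2 * sqrt 3) ltac:(lra)).
assert (H : 1.85 < sqrt (2 * sqrt 3)).
{ apply lt_of_sq_lt; [apply sqrt_pos | lra]. }
assert (H' : sqrt (2 * sqrt 3) < 1.9).
{ apply lt_of_sq_lt; [lra | rewrite E; lra]. }
unfold d1_bar; lra.
Qed.

Lemma r4_limit : filterlim r4 (at_left 1) (Rbar_locally p_infty).
Proof.
intros P [M HM].
set (M' := Rmax M rs).
assert (H1 : rs <= M') by apply Rmax_r.
assert (H2 : M <= M') by apply Rmax_l.
assert (Hrs := rs_gt); assert (Hd1 := d1_tilde_bounds).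
assert (Hg : hg M' < 1) by (apply hg_lt1; generalize sqrt2_bounds; lra).
unfold filtermap, at_left, within.
(* [(1 + hg M') / 2] is the drift at which [r4] takes the value [M']. *)
apply (filter_imp (fun d => (1 + hg M') / 2 < d /\ d1_tilde < d)).
- intros d [Hd Hd'] Hlt; apply HM.
  destruct (r4_spec d ltac:(lra)) as [Hr E].
  apply Rle_lt_trans with (1 := H2).
  destruct (Rlt_le_dec M' (r4 d)) as [|Hle]; [easy | exfalso].
  destruct Hle as [Hle | Eq]; [| rewrite Eq in E; lra].
  generalize (hg_increasing _ _ Hr Hle); lra.
- apply filter_and; apply open_gt; lra.
Qed.

(** * The threshold [r1_bar] and its position relative to [r3] *)

Lemma hy_lt m n : 0 <= m -> m < n -> n < 1 -> hy n < hy m.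
Proof. intros; apply sqrt_lt_1; nra. Qed.

Lemma hy_d1_bar : 2 * hy (2 * d1_bar - 1) + 2 * hy (2 * d1_bar - 1) ^ 2 = 1.
Proof.
assert (H3 := sqrt3_bounds); assert (E3 := sqrt_sq 3 ltac:(lra)).
(* The positive root of [2 y ^ 2 + 2 y = 1]. *)
assert (E : hy (2 * d1_bar - 1) = (sqrt 3 - 1) / 2).
{ assert (Hd := d1_bar_bounds).
  apply eq_of_sq_eq; [apply sqrt_pos | lra |].
  rewrite hy_sq by lra.
  unfold d1_bar.
  replace ((2 * (1 / 2 + 1 / 4 * sqrt (2 * sqrt 3)) - 1) ^ 2) with (sqrt (2 * sqrt 3) ^ 2 / 4) by field.
  rewrite sqrt_sq by lra; nra. }
rewrite E; nra.
Qed.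

Lemma hy_d0_tilde : hy (2 * d0_tilde - 1) = 1 / 2.
Proof.
assert (H3 := sqrt3_bounds); assert (E3 := sqrt_sq 3 ltac:(lra)).
assert (Hd := d0_tilde_bounds).
apply eq_of_sq_eq; [apply sqrt_pos | lra |].
rewrite hy_sq by lra; unfold d0_tilde; nra.
Qed.

Lemma r1_bar_decreasing : decreasing_on (fun d => 1 / 2 <= d <= d1_bar) r1_bar.
Proof.
intros x y Hx Hy Hxy; unfold r1_bar.
assert (Hd := d1_bar_bounds).
assert (H1 : hy (2 * y - 1) < hy (2 * x - 1)) by (apply hy_lt; lra).
(* This keeps the radicands nonnegative; on negative arguments [sqrt] is constant and strictness
   would fail. *)
assert (H2 : hy (2 * d1_bar - 1) <= hy (2 * y - 1)).
{ destruct (proj2 Hy) as [H | ->]; [apply Rlt_le, hy_lt; lra | lra]. }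
assert (E := hy_d1_bar); assert (H0 : 0 <= hy (2 * d1_bar - 1)) by apply sqrt_pos.
apply hR_lt; split; [apply sqrt_pos | apply sqrt_lt_1; nra].
Qed.

Lemma r1_bar_continuous : continuous_on (fun d => 1 / 2 <= d <= d1_bar) r1_bar.
Proof.
apply continuous_on_forall.
intros d _; unfold r1_bar, hR, hS, hy.
assert (Hs : forall f : R -> R, continuous f d -> continuous (fun x => sqrt (f x)) d).
{ intros f Hf; apply (continuous_comp f sqrt); [easy | apply continuous_sqrt]. }
assert (Hp : forall f g : R -> R, continuous f d -> continuous g d ->
  continuous (fun x => f x + g x) d).
{ intros f g; apply (continuous_plus f g). }
assert (Hm : forall f g : R -> R, continuous f d -> continuous g d ->
  continuous (fun x => f x * g x) d).
{ intros f g; apply (continuous_mult f g). }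
assert (Hq : forall f : R -> R, continuous f d -> continuous (fun x => f x ^ 2) d).
{ intros f Hf; simpl; apply Hm; [easy | apply Hm; [easy | apply continuous_const]]. }
assert (Hc : forall c : R, continuous (fun _ : R => c) d) by (intros; apply continuous_const).
assert (Hi : continuous (fun x : R => x) d) by apply continuous_id.
assert (Hy : continuous (fun x => sqrt (1 - (2 * x - 1) ^ 2)) d).
{ apply (continuous_ext (fun x => sqrt (1 + (-1) * (2 * x + -1) ^ 2))).
  { intros x; f_equal; unfold Rminus; ring. }
  auto 10. }
assert (HB : continuous (fun x => sqrt (2 * sqrt (1 - (2 * x - 1) ^ 2)
  + 2 * sqrt (1 - (2 * x - 1) ^ 2) ^ 2 - 1)) d) by (unfold Rminus at 1; auto 10).
auto 10.
Qed.

Lemma hF_min_sq m : 0 <= m < 1 ->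
  0 <= hF m (- tau m) /\ hF m (- tau m) ^ 2 = 2 * hy m + 2 * hy m ^ 2.
Proof.
intros Hm; assert (Hb := hy_bounds m Hm); assert (Et := tau_sq m Hm).
assert (Hs := hS_pos (tau m)); assert (Es := hS_sq (tau m)).
rewrite hF_min by easy; split; [nra|].
rewrite !Rpow_mult_distr, Es; nra.
Qed.

Lemma r1_bar_ge1 d : 1 <= r1_bar d.
Proof. apply hR_ge1, sqrt_pos. Qed.

Lemma hF_min_ge d r : 1 / 2 <= d < 1 -> 1 < r <= r1_bar d ->
  hS (hT r) <= hF (2 * d - 1) (- tau (2 * d - 1)).
Proof.
intros Hd Hr; assert (HT := hT_pos r ltac:(lra)).
destruct (hF_min_sq (2 * d - 1) ltac:(lra)) as [H0 E].
assert (Hle : hT r <= sqrt (2 * hy (2 * d - 1) + 2 * hy (2 * d - 1) ^ 2 - 1)).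
{ rewrite <- (hT_hR (sqrt _)) by apply sqrt_pos; fold (r1_bar d).
  destruct (proj2 Hr) as [H | <-]; [apply Rlt_le, hT_lt; lra | lra]. }
set (B := 2 * hy (2 * d - 1) + 2 * hy (2 * d - 1) ^ 2) in *.
assert (HB : 0 <= B - 1).
(* A negative radicand would give [hT r <= 0], against [1 < r]. *)
{ destruct (Rle_lt_dec 0 (B - 1)) as [|H]; [easy|].
  rewrite sqrt_neg_0 in Hle; lra. }
assert (EB := sqrt_sq (B - 1) HB).
apply le_of_sq_le; [easy|]; rewrite E, hS_sq; nra.
Qed.

(** The second conclusion places the minimiser inside [(- T, T)], so that the first one really
    concerns a point of the interval. *)
Lemma hF_min_lt d r : 1 / 2 <= d < 1 -> r1_bar d < r ->
  hF (2 * d - 1) (- tau (2 * d - 1)) < hS (hT r) /\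
  (1 / 2 < hy (2 * d - 1) -> tau (2 * d - 1) < hT r).
Proof.
intros Hd Hr; assert (H1 := r1_bar_ge1 d).
destruct (hF_min_sq (2 * d - 1) ltac:(lra)) as [H0 E].
assert (Hlt : sqrt (2 * hy (2 * d - 1) + 2 * hy (2 * d - 1) ^ 2 - 1) < hT r).
{ rewrite <- (hT_hR (sqrt _)) by apply sqrt_pos; fold (r1_bar d).
  apply hT_lt; lra. }
assert (Ht := tau_sq (2 * d - 1) ltac:(lra)); assert (Ht0 := tau_ge0 (2 * d - 1)).
assert (Hy := hy_bounds (2 * d - 1) ltac:(lra)).
set (y := hy (2 * d - 1)) in *.
assert (HB0 := sqrt_pos (2 * y + 2 * y ^ 2 - 1)).
assert (HB : 2 * y + 2 * y ^ 2 - 1 < hT r ^ 2).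
{ destruct (Rle_lt_dec 0 (2 * y + 2 * y ^ 2 - 1)) as [H|]; [| nra].
  assert (EB := sqrt_sq _ H); nra. }
split.
- apply lt_of_sq_lt; [apply Rlt_le, hS_pos | rewrite E, hS_sq; lra].
- intros H; apply lt_of_sq_lt; [lra|].
  apply Rlt_trans with (2 := HB).
  apply Rmult_lt_reg_l with (2 * y); [lra|].
  rewrite Ht.
  (* This product is [2 y (2 y + 2 y ^ 2 - 1) - (1 - y)]. *)
  assert (0 < (y + 1) * (4 * y ^ 2 - 1)) by (apply Rmult_lt_0_compat; nra).
  nra.
Qed.

(** A crude numerical bound suffices. It puts [r1_bar d] on the decreasing branch of [hg], where it
    can be compared with [r3 d] through the values of [hg]. *)
Lemma r1_bar_le_rs d : d1_tilde <= d < 1 -> r1_bar d <= rs.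
Proof.
intros Hd; assert (Hrs := rs_gt); assert (H1 := d1_tilde_bounds).
assert (Ey := hy_sq (2 * d - 1) ltac:(lra)).
assert (Hy := hy_bounds (2 * d - 1) ltac:(lra)).
unfold r1_bar; set (y := hy (2 * d - 1)) in *.
assert (Hy1 : y < 0.543) by (apply lt_of_sq_lt; nra).
assert (HT : sqrt (2 * y + 2 * y ^ 2 - 1) < 0.83).
{ destruct (Rle_lt_dec 0 (2 * y + 2 * y ^ 2 - 1)) as [H | H].
  - apply lt_of_sq_lt; [lra | rewrite sqrt_sq by easy; nra].
  - rewrite sqrt_neg_0; lra. }
assert (HT0 := sqrt_pos (2 * y + 2 * y ^ 2 - 1)).
set (T := sqrt _) in *.
assert (HS : hS T < 1.3).
{ apply lt_of_sq_lt; [lra | rewrite hS_sq; nra]. }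
assert (Hs := hS_pos T).
unfold hR; nra.
Qed.

(** At [r = r1_bar d] the level [hS T1] is the minimum of [hF], so the endpoint value is at least
    the level, with equality only if [T1 = tau], that is [y = 1 / 2] or [d = d0_tilde]. Thus
    [hg (r1_bar d) >= 2 d - 1], and the decreasing branch of [hg] gives the order. *)
Lemma r1_bar_vs_r3 d : d1_tilde <= d <= d1_bar ->
  (d = d0_tilde -> r1_bar d = r3 d) /\ (d <> d0_tilde -> r1_bar d < r3 d).
Proof.
intros Hd; assert (Hb1 := d1_tilde_bounds); assert (Hb0 := d0_tilde_bounds).
assert (Hb := d1_bar_bounds).
assert (Hle := r1_bar_le_rs d ltac:(lra)).
destruct (r3_spec d ltac:(lra)) as [H3 E3].
destruct (hF_min_sq (2 * d - 1) ltac:(lra)) as [Hm0 Em].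
assert (Ht := tau_sq (2 * d - 1) ltac:(lra)); assert (Ht0 := tau_ge0 (2 * d - 1)).
assert (Hy := hy_bounds (2 * d - 1) ltac:(lra)).
set (T1 := sqrt (2 * hy (2 * d - 1) + 2 * hy (2 * d - 1) ^ 2 - 1)).
assert (HT0 : 0 <= T1) by apply sqrt_pos.
assert (ER : r1_bar d = hR T1) by easy.
assert (ET : hT (r1_bar d) = T1) by now apply hT_hR.
assert (HT1 : T1 ^ 2 = 2 * hy (2 * d - 1) + 2 * hy (2 * d - 1) ^ 2 - 1).
{ apply sqrt_sq.
  assert (E := hy_d1_bar).
  assert (0 < hy (2 * d1_bar - 1)) by (apply hy_bounds; lra).
  destruct (proj2 Hd) as [Hlt | ->]; [| lra].
  assert (hy (2 * d1_bar - 1) < hy (2 * d - 1)) by (apply hy_lt; lra).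
  nra. }
assert (ES : hS T1 = hF (2 * d - 1) (- tau (2 * d - 1))).
{ apply hS_unique; [easy | rewrite Em; lra]. }
destruct HT0 as [HT0 | HT0].
- assert (Hr1 : 1 < r1_bar d) by (rewrite ER; now apply hR_gt1).
  split; intros Hne.
  + assert (Ey : hy (2 * d - 1) = 1 / 2) by (rewrite Hne; apply hy_d0_tilde).
    rewrite Ey in *.
    assert (E : T1 = tau (2 * d - 1)) by (apply eq_of_sq_eq; lra).
    destruct (hF_boundary (2 * d - 1) (r1_bar d) Hr1) as [c [Hc Ec]].
    rewrite ET, ES, E in Ec.
    assert (Eg : hg (r1_bar d) = 2 * d - 1).
    { symmetry in Ec; rewrite Rminus_diag in Ec; apply Rmult_integral in Ec; lra. }
    destruct (Rtotal_order (r1_bar d) (r3 d)) as [H | [H | H]]; [exfalso | easy | exfalso].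
    * generalize (hg_decreasing _ _ Hr1 H ltac:(lra)); lra.
    * generalize (hg_decreasing (r3 d) (r1_bar d) ltac:(lra) H ltac:(lra)); lra.
  + assert (HneT : T1 <> tau (2 * d - 1)).
    { intros E; apply Hne.
      set (y := hy (2 * d - 1)) in *.
      rewrite <- E, HT1 in Ht.
      assert (Ey : y = 1 / 2).
      { assert (E' : (y + 1) * (2 * y + 1) * (2 * y - 1) = 0) by lra.
        apply Rmult_integral in E'; destruct E' as [E' | E']; [exfalso; nra | lra]. }
      destruct (Rtotal_order d d0_tilde) as [H | [H | H]]; [exfalso | easy | exfalso].
      - assert (hy (2 * d0_tilde - 1) < y) by (apply hy_lt; lra).
        rewrite hy_d0_tilde in *; lra.
      - assert (y < hy (2 * d0_tilde - 1)) by (apply hy_lt; lra).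
        rewrite hy_d0_tilde in *; lra. }
    assert (Hg : 2 * d - 1 < hg (r1_bar d)).
    { apply hF_boundary_gt; [easy|].
      rewrite ET, ES.
      destruct (Rtotal_order T1 (tau (2 * d - 1))) as [H | [H | H]]; [| easy |].
      - apply hF_increasing; lra.
      - apply hF_decreasing; lra. }
    destruct (Rlt_le_dec (r1_bar d) (r3 d)) as [|H]; [easy | exfalso].
    destruct H as [H | H]; [| rewrite H in E3; lra].
    generalize (hg_decreasing (r3 d) (r1_bar d) ltac:(lra) H ltac:(lra)); lra.
(* [T1 = 0] gives [r = 1], where [hg] has its pole; here [1 < r3 d] is enough. *)
- assert (r1_bar d = 1).
  { rewrite ER, <- HT0; unfold hR, hS.
    replace (1 + 0 ^ 2) with 1 by ring; rewrite sqrt_1; ring. }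
  split; [| lra].
  intros E; exfalso; rewrite E, hy_d0_tilde in HT1; rewrite <- HT0 in HT1; lra.
Qed.

(** * Concavity and inflexion points in each range of [d] *)

Lemma half_lt_hy d : 1 / 2 <= d < d0_tilde -> 1 / 2 < hy (2 * d - 1).
Proof.
intros Hd; generalize d0_tilde_bounds; intros; rewrite <- hy_d0_tilde; apply hy_lt; lra.
Qed.

Lemma hy_le_half d : d0_tilde <= d < 1 -> hy (2 * d - 1) <= 1 / 2.
Proof.
intros [[H | <-] H1]; rewrite <- hy_d0_tilde; [| lra].
generalize d0_tilde_bounds; intros; apply Rlt_le, hy_lt; lra.
Qed.

Lemma flux_two_of_min d r : 1 / 2 <= d < 1 -> 1 < r -> 2 * d - 1 < hg r ->
  tau (2 * d - 1) < hT r -> hF (2 * d - 1) (- tau (2 * d - 1)) < hS (hT r) ->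
  two_inflexion_points (two_lane_flux d (1 - d) r).
Proof.
intros Hd Hr Hg Ht Hm; assert (H0 := tau_ge0 (2 * d - 1)).
apply (flux_two_of_hF d r (- tau (2 * d - 1))); try lra.
now apply hF_boundary_gt.
Qed.

Lemma strictly_concave_below_r1_bar d r : 1 / 2 <= d < 1 -> 1 <= r <= r1_bar d ->
  strictly_concave (two_lane_flux d (1 - d) r).
Proof.
intros Hd [[Hr | <-] Hle]; [| apply flux_concave_r1].
apply flux_concave_below_min; [easy | easy | apply hF_min_ge; lra].
Qed.

(* The value of [r] for which the minimiser of [hF] sits at the endpoint [rho = 2]. *)
Definition r0 (d : R) : R := hR (tau (2 * d - 1)).

(** At [r0 d] the endpoint value is the minimum [2 y hS T], which is at most [hS T] exactly because
    [y <= 1 / 2]. So [hg (r0 d) <= 2 d - 1], which places [r0 d] between the two branches. *)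
Lemma r0_between d : d0_tilde <= d < 1 ->
  1 < r0 d /\ r3 d <= r0 d <= r4 d /\ hT (r0 d) = tau (2 * d - 1) /\
  hF (2 * d - 1) (- tau (2 * d - 1)) <= hS (hT (r0 d)).
Proof.
intros Hd; assert (Hb1 := d1_tilde_bounds); assert (Hb0 := d0_tilde_bounds).
assert (Hy2 := hy_le_half d Hd).
assert (Hy := hy_bounds (2 * d - 1) ltac:(lra)).
assert (Ht := tau_sq (2 * d - 1) ltac:(lra)); assert (Ht0 := tau_ge0 (2 * d - 1)).
assert (Htp : 0 < tau (2 * d - 1)) by nra.
assert (ET : hT (r0 d) = tau (2 * d - 1)) by now apply hT_hR.
assert (H1 : 1 < r0 d) by now apply hR_gt1.
assert (Hm : hF (2 * d - 1) (- tau (2 * d - 1)) <= hS (hT (r0 d))).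
{ rewrite hF_min, ET by lra; assert (Hs := hS_pos (tau (2 * d - 1))); nra. }
assert (Hg : hg (r0 d) <= 2 * d - 1).
{ destruct (Rle_lt_dec (hg (r0 d)) (2 * d - 1)) as [|H]; [easy | exfalso].
  apply (hF_boundary_gt _ _ H1) in H; rewrite ET in *; lra. }
repeat split; auto.
- destruct (Rle_lt_dec (r3 d) (r0 d)) as [|H]; [easy | exfalso].
  generalize (hg_below_r3 d (r0 d)); lra.
- destruct (Rle_lt_dec (r0 d) (r4 d)) as [|H]; [easy | exfalso].
  generalize (hg_above_r4 d (r0 d)); lra.
Qed.

(** Here [2 d - 1] is below the least value of [hg], so both endpoints stay concave for every
    [r > 1] and only the interior minimum decides. *)
Lemma flux_case_i d r : 1 / 2 <= d < d1_tilde -> r1_bar d < r ->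
  two_inflexion_points (two_lane_flux d (1 - d) r).
Proof.
intros Hd Hr; assert (Hb1 := d1_tilde_bounds); assert (Hb0 := d0_tilde_bounds).
assert (H1 := r1_bar_ge1 d).
destruct (hF_min_lt d r ltac:(lra) Hr) as [Hm Ht].
apply flux_two_of_min; try lra.
- generalize (hg_ge r ltac:(lra)) hg_rs_d1; lra.
- apply Ht, half_lt_hy; lra.
Qed.

Lemma flux_case_ii_two d r : d1_tilde <= d < d0_tilde -> r1_bar d < r ->
  r < r3 d \/ r4 d < r -> two_inflexion_points (two_lane_flux d (1 - d) r).
Proof.
intros Hd Hr Hc; assert (Hb1 := d1_tilde_bounds); assert (Hb0 := d0_tilde_bounds).
assert (H1 := r1_bar_ge1 d).
destruct (hF_min_lt d r ltac:(lra) Hr) as [Hm Ht].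
apply flux_two_of_min; try lra.
- destruct Hc; [apply hg_below_r3 | apply hg_above_r4]; lra.
- apply Ht, half_lt_hy; lra.
Qed.

Lemma flux_case_ii_single d r : d1_tilde <= d < d0_tilde -> r1_bar d < r ->
  r3 d <= r <= r4 d -> single_inflexion_point (two_lane_flux d (1 - d) r).
Proof.
intros Hd Hr Hc; assert (Hb1 := d1_tilde_bounds); assert (Hb0 := d0_tilde_bounds).
assert (H1 := r1_bar_ge1 d).
destruct (hF_min_lt d r ltac:(lra) Hr) as [Hm Ht].
assert (Ht' := Ht (half_lt_hy d ltac:(lra))).
assert (H0 := tau_ge0 (2 * d - 1)).
apply (flux_single_of_hF d r (- tau (2 * d - 1))); try lra.
destruct (Rle_lt_dec (hF (2 * d - 1) (- hT r)) (hS (hT r))) as [|H]; [easy | exfalso].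
apply hF_boundary_gt in H; [| lra].
destruct (r3_spec d ltac:(lra)) as [H3 E3]; destruct (r4_spec d ltac:(lra)) as [H4 E4].
destruct (Req_dec r (r3 d)) as [E | N3]; [rewrite E in H; lra|].
destruct (Req_dec r (r4 d)) as [E | N4]; [rewrite E in H; lra|].
generalize (hg_between d r); lra.
Qed.

Lemma flux_single_of_hg d r : 1 / 2 <= d -> 1 < r -> hg r < 2 * d - 1 ->
  single_inflexion_point (two_lane_flux d (1 - d) r).
Proof.
intros Hd Hr Hg; assert (HT := hT_pos r Hr).
apply (hF_boundary_lt _ r Hr) in Hg.
apply (flux_single_of_hF d r (- hT r)); lra.
Qed.

(** For [d < 1], [r <= r3 d <= r0 d] forces [T <= tau], so the endpoint criterion is the only one
    left. *)
Lemma flux_concave_below_r3 d r : d0_tilde <= d -> 1 <= r <= r3 d ->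
  strictly_concave (two_lane_flux d (1 - d) r).
Proof.
intros Hd [[Hr | <-] Hle]; [| apply flux_concave_r1].
assert (Hb1 := d1_tilde_bounds); assert (Hb0 := d0_tilde_bounds).
apply flux_concave_boundary; try lra.
- intros H1; destruct (r0_between d) as [H0 [[H3 _] [<- _]]]; [lra|].
  destruct (Rle_lt_or_eq_dec r (r0 d)) as [H | ->]; [lra | apply Rlt_le, hT_lt | ]; lra.
- destruct Hle as [H | ->].
  + apply Rlt_le, hg_below_r3; lra.
  + destruct (r3_spec d); lra.
Qed.

(** [r > r4 d >= r0 d] forces [T > tau]: the minimiser is interior, and [hS T] has grown past the
    minimum, already reached at [r0 d]. *)
Lemma flux_case_iii_two d r : d0_tilde <= d < 1 -> r4 d < r ->
  two_inflexion_points (two_lane_flux d (1 - d) r).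
Proof.
intros Hd Hr; assert (Hb1 := d1_tilde_bounds); assert (Hb0 := d0_tilde_bounds).
destruct (r0_between d Hd) as [H0 [[H3 H4] [ET Hm]]].
assert (Hlt : hT (r0 d) < hT r) by (apply hT_lt; lra).
assert (hS (hT (r0 d)) < hS (hT r)).
{ apply hS_lt; split; [apply hT_ge0 |]; lra. }
apply flux_two_of_min; try lra.
apply hg_above_r4; lra.
Qed.

Lemma r3_1 : r3 1 = 1 + sqrt 2.
Proof.
assert (Hb1 := d1_tilde_bounds); assert (H2 := sqrt2_bounds); assert (Hrs := rs_gt).
destruct (r3_spec 1 ltac:(lra)) as [H E].
assert (E2 : hg (1 + sqrt 2) = 1).
{ apply hg_eq_of_hgap; [lra|].
  assert (Es := sqrt_sq 2 ltac:(lra)).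
  replace (hgap 1 (1 + sqrt 2)) with (- 2 * (sqrt 2 ^ 2 - 2)) by (unfold hgap; ring).
  rewrite Es; ring. }
destruct (Rtotal_order (r3 1) (1 + sqrt 2)) as [Hc | [Hc | Hc]]; [exfalso | easy | exfalso].
- generalize (hg_decreasing (r3 1) (1 + sqrt 2) ltac:(lra) Hc ltac:(lra)); lra.
- generalize (hg_decreasing (1 + sqrt 2) (r3 1) ltac:(lra) Hc ltac:(lra)); lra.
Qed.

(** * Zeros and extrema of the flux *)

Lemma flux_endpoints d r : 1 <= r ->
  two_lane_flux d (1 - d) r 0 = 0 /\ two_lane_flux d (1 - d) r 2 = 0.
Proof.
intros [Hr | <-].
- assert (HT := hT_pos r Hr).
  rewrite !flux_eq by easy.
  replace (hT r * (1 - 0)) with (hT r) by ring.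
  replace (hT r * (1 - 2)) with (- hT r) by ring.
  rewrite hS_opp; split; field; lra.
- unfold two_lane_flux, phi.
  destruct (Req_EM_T 1 1) as [_ | H]; [split; field | now elim H].
Qed.

Lemma flux_sign d r rho : 1 < r -> 0 < rho < 2 ->
  let t := hT r * (1 - rho) in
  exists c, 0 < c /\ two_lane_flux d (1 - d) r rho = c * (hS t + (2 * d - 1) * t).
Proof.
intros Hr Hrho t; assert (HT := hT_pos r Hr).
exists ((hS (hT r) - hS t) / (2 * hT r ^ 2)); split.
- apply Rdiv_lt_0_compat; [| nra].
  assert (hS t < hS (hT r)); [| lra].
  apply lt_of_sq_lt; [apply Rlt_le, hS_pos|].
  rewrite !hS_sq.
  assert (0 < hT r ^ 2 * (rho * (2 - rho))) by (apply Rmult_lt_0_compat; nra).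
  unfold t; lra.
- rewrite flux_eq by easy; fold t; field; lra.
Qed.

(** Both inequalities express [0 <= d - r (d - 1)]. The right one says that the factor [hS t + m t]
    of the flux is still nonnegative at [t = - T], that is at [rho = 2]. *)
Lemma ratio_le_iff d r : 1 < d -> 1 < r ->
  r <= d / (d - 1) <-> (2 * d - 1) * hT r <= hS (hT r).
Proof.
intros Hd Hr; assert (Hs : 0 < sqrt r) by (apply sqrt_lt_R0; lra).
rewrite hS_hT by lra; unfold hT.
assert (E1 : d / (d - 1) - r = (d - r * (d - 1)) / (d - 1)) by (field; lra).
assert (E2 : (r + 1) / (2 * sqrt r) - (2 * d - 1) * ((r - 1) / (2 * sqrt r))
  = (d - r * (d - 1)) / sqrt r) by (field; lra).
assert (H1 : d - r * (d - 1) = (d / (d - 1) - r) * (d - 1)) by (field; lra).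
assert (H2 : d - r * (d - 1) = ((r + 1) / (2 * sqrt r)
  - (2 * d - 1) * ((r - 1) / (2 * sqrt r))) * sqrt r) by (field; lra).
clear E1 E2; split; nra.
Qed.

Lemma hS_lin_pos m t : 1 < m -> (0 <= t \/ (m ^ 2 - 1) * t ^ 2 < 1) -> 0 < hS t + m * t.
Proof.
intros Hm Ht; assert (Hs := hS_pos t).
destruct (Rle_lt_dec 0 t) as [H | H]; [nra|].
destruct Ht as [Ht | Ht]; [lra|].
assert (- (m * t) < hS t); [| lra].
apply lt_of_sq_lt; [lra | rewrite hS_sq; nra].
Qed.

Lemma hS_lin_neg m t : 1 < m -> t < 0 -> 1 < (m ^ 2 - 1) * t ^ 2 -> hS t + m * t < 0.
Proof.
intros Hm H Ht; assert (Hs := hS_pos t).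
assert (hS t < - (m * t)); [| lra].
apply lt_of_sq_lt; [nra | rewrite hS_sq; nra].
Qed.

Lemma flux_positive d r : 1 < d -> 1 < r <= d / (d - 1) ->
  positive_on (fun x => 0 < x < 2) (two_lane_flux d (1 - d) r).
Proof.
intros Hd [Hr Hle] x Hx; assert (HT := hT_pos r Hr).
apply (ratio_le_iff d r Hd Hr) in Hle.
destruct (flux_sign d r x Hr Hx) as [c [Hc ->]].
apply Rmult_lt_0_compat; [easy|]; apply hS_lin_pos; [lra|].
set (T := hT r) in *; set (m := 2 * d - 1) in *.
assert (HmT : (m ^ 2 - 1) * T ^ 2 <= 1).
{ assert (Es := hS_sq T); assert (Hs := hS_pos T).
  assert (0 <= m * T) by (unfold m; nra).
  assert ((m * T) ^ 2 <= hS T ^ 2) by nra; nra. }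
right; apply Rlt_le_trans with (2 := HmT).
apply Rmult_lt_compat_l; [unfold m; nra|].
assert (0 < T ^ 2 * (x * (2 - x))) by (apply Rmult_lt_0_compat; nra).
lra.
Qed.

Lemma local_max_critical (f : R -> R) (df x : R) : is_derive f x df -> local_max f x -> df = 0.
Proof.
intros Hf [eps He]; apply is_derive_Reals in Hf.
assert (H0 := cond_pos eps).
set (pr := exist _ df Hf : derivable_pt f x).
rewrite <- (derive_pt_eq_0 f x df pr Hf).
apply (deriv_maximum f (x - eps) (x + eps)); try lra.
intros y H1 H2; apply He.
unfold ball; simpl; unfold AbsRing_ball, abs, minus, plus, opp; simpl.
apply Rabs_def1; lra.
Qed.

Lemma local_max_exists (f df : R -> R) a b :
  a < b -> (forall x, is_derive f x (df x)) -> f a = 0 -> f b = 0 ->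
  (forall x, a < x < b -> 0 < f x) -> exists x, a < x < b /\ local_max f x.
Proof.
intros Hab Hf Ha Hb Hpos.
destruct (continuity_ab_maj f a b (Rlt_le _ _ Hab)) as [x [Hmax Hx]].
{ intros c _; apply derivable_continuous_pt; eexists; apply is_derive_Reals, Hf. }
assert (Hmid := Hmax ((a + b) / 2) ltac:(lra)).
assert (Hp := Hpos ((a + b) / 2) ltac:(lra)).
assert (Hx' : a < x < b).
{ split.
  - destruct (Req_dec x a) as [-> | ]; lra.
  - destruct (Req_dec x b) as [-> | ]; lra. }
exists x; split; [easy|]; unfold local_max.
apply (filter_imp (fun y => a < y /\ y < b)).
- intros y Hy; apply Hmax; lra.
- apply filter_and; [apply open_gt | apply open_lt]; easy.
Qed.

Lemma local_min_opp f x : local_min f x <-> local_max (fun y => - f y) x.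
Proof.
unfold local_min, local_max; split; apply filter_imp; intros y H; lra.
Qed.

(** Each side of [z] carries at least one extremum. A further one would give three zeros of [df],
    and strict quasi-convexity forbids that the middle of three points share its value with both
    others. *)
Lemma unique_extrema (f df : R -> R) z :
  (forall x, is_derive f x (df x)) ->
  strictly_quasiconvex_on (fun x => 0 <= x <= 2) df ->
  0 < z < 2 -> f 0 = 0 -> f z = 0 -> f 2 = 0 ->
  positive_on (fun x => 0 < x < z) f -> negative_on (fun x => z < x < 2) f ->
  (exists! x, 0 < x < z /\ local_max f x) /\ (exists! x, z < x < 2 /\ local_min f x).
Proof.
intros Hf Hq Hz f0 fz f2 Hpos Hneg.
assert (Hf' : forall x, is_derive (fun y => - f y) x (- df x)).
{ intros x; apply (is_derive_opp f x (df x)), Hf. }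
assert (Cmax : forall x, local_max f x -> df x = 0).
{ intros x; now apply local_max_critical. }
assert (Cmin : forall x, local_min f x -> df x = 0).
{ intros x Hx; apply local_min_opp in Hx.
  assert (E := local_max_critical _ _ x (Hf' x) Hx); lra. }
destruct (local_max_exists f df 0 z) as [x1 [H1 M1]]; auto; [lra|].
destruct (local_max_exists (fun y => - f y) (fun y => - df y) z 2) as [x2 [H2 M2]];
  auto; try lra.
{ intros x Hx; generalize (Hneg x Hx); lra. }
apply local_min_opp in M2.
assert (H3 : forall x y w, 0 < x < y -> y < w < 2 -> df x = 0 -> df y = 0 -> df w = 0 -> False).
{ intros x y w Hx Hy Ex Ey Ew.
  destruct (Hq x y w) as [H | H]; lra. }
split.
- exists x1; split; [easy|]; intros x [Hx M].
  destruct (Rtotal_order x1 x) as [H | [H | H]]; [exfalso | easy | exfalso].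
  + apply (H3 x1 x x2); auto; lra.
  + apply (H3 x x1 x2); auto; lra.
- exists x2; split; [easy|]; intros x [Hx M].
  destruct (Rtotal_order x2 x) as [H | [H | H]]; [exfalso | easy | exfalso].
  + apply (H3 x1 x2 x); auto; lra.
  + apply (H3 x1 x x2); auto; lra.
Qed.

Lemma flux_sign_change d r : 1 < d -> 1 < r -> d / (d - 1) < r ->
  let G := two_lane_flux d (1 - d) r in
  single_inflexion_point G /\
  exists z,
    (forall x, 0 < x < 2 /\ G x = 0 <-> x = z) /\
    positive_on (fun x => 0 < x < z) G /\
    (exists! x, 0 < x < z /\ local_max G x) /\
    negative_on (fun x => z < x < 2) G /\
    (exists! x, z < x < 2 /\ local_min G x).
Proof.
intros Hd Hr Hgt G; assert (HT := hT_pos r Hr).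
assert (Hlt : hS (hT r) < (2 * d - 1) * hT r).
{ destruct (Rlt_le_dec (hS (hT r)) ((2 * d - 1) * hT r)) as [|H]; [easy | exfalso].
  apply (ratio_le_iff d r Hd Hr) in H; lra. }
assert (Hs := hS_pos (hT r)); assert (Es := hS_sq (hT r)).
(* With [m = 2 d - 1] this amounts to [(1 + 2 T ^ 2) hS T < (3 + 2 T ^ 2) m T], which follows from
   [Hlt]. *)
assert (HF : hF (2 * d - 1) (- hT r) < hS (hT r)).
{ unfold hF; rewrite hS_opp.
  replace (2 * hS (hT r) ^ 3) with (2 * hS (hT r) ^ 2 * hS (hT r)) by ring.
  rewrite Es; nra. }
assert (Hm : 1 < 2 * d - 1) by lra.
destruct (flux_single_sign (2 * d - 1) r (- hT r) Hr) as [x0 [H0 [Hn Hp]]]; try lra.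
assert (Hq : strictly_quasiconvex_on (fun x => 0 <= x <= 2) (dflux (2 * d - 1) r)).
{ apply (quasiconvex_of_unimodal 0 2 x0).
  - apply decreasing_of_derive with (2 := Hn); intros; now apply is_derive_dflux.
  - apply increasing_of_derive with (2 := Hp); intros; now apply is_derive_dflux. }
split.
{ apply (single_inflexion_of_sign _ x0 H0); intros x Hx; unfold G; rewrite Derive2_flux; auto. }
set (m := 2 * d - 1) in *; set (T := hT r) in *.
(* [- s] is the zero of [hS t + m t], from [1 + s ^ 2 = m ^ 2 s ^ 2]; [Hlt] places it inside
   [(- T, 0)]. *)
set (s := / sqrt (m ^ 2 - 1)).
assert (Hq0 : 0 < sqrt (m ^ 2 - 1)) by (apply sqrt_lt_R0; nra).
assert (Hs0 : 0 < s) by now apply Rinv_0_lt_compat.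
assert (Hs1 : (m ^ 2 - 1) * s ^ 2 = 1).
{ unfold s; rewrite <- (sqrt_sq (m ^ 2 - 1)) at 1 by nra; field; lra. }
assert (HsT : s < T).
{ apply lt_of_sq_lt; [lra|].
  apply Rmult_lt_reg_l with (m ^ 2 - 1); [nra|].
  rewrite Hs1; nra. }
assert (Es0 : hS (- s) = m * s).
{ apply hS_unique; [nra|]; nra. }
set (z := 1 + s / T).
assert (Ez : forall x, T * (1 - x) + s = T * (z - x)) by (intros; unfold z; field; lra).
assert (Hz : 0 < z < 2).
{ generalize (Ez 0) (Ez 2); nra. }
assert (Hpos : positive_on (fun x => 0 < x < z) G).
{ intros x Hx; destruct (flux_sign d r x Hr ltac:(lra)) as [c [Hc E]].
  unfold G; rewrite E; fold T m.
  apply Rmult_lt_0_compat; [easy|]; apply hS_lin_pos; [easy|].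
  assert (- s < T * (1 - x)) by (generalize (Ez x); nra).
  destruct (Rle_lt_dec 0 (T * (1 - x))); [now left | right].
  apply Rlt_le_trans with (2 := Req_le _ _ Hs1); apply Rmult_lt_compat_l; nra. }
assert (Hneg : negative_on (fun x => z < x < 2) G).
{ intros x Hx; destruct (flux_sign d r x Hr ltac:(lra)) as [c [Hc E]].
  unfold G; rewrite E; fold T m.
  assert (T * (1 - x) < - s) by (generalize (Ez x); nra).
  assert (hS (T * (1 - x)) + m * (T * (1 - x)) < 0); [| nra].
  apply hS_lin_neg; [easy | lra |].
  apply Rle_lt_trans with (1 := Req_le _ _ (eq_sym Hs1)); apply Rmult_lt_compat_l; nra. }
assert (Gz : G z = 0).
{ destruct (flux_sign d r z Hr Hz) as [c [Hc E]].
  unfold G; rewrite E; fold T m.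
  replace (T * (1 - z)) with (- s) by (generalize (Ez z); lra).
  rewrite Es0; ring. }
destruct (flux_endpoints d r) as [G0 G2]; [lra|].
destruct (unique_extrema G (dflux m r) z) as [Hmax Hmin]; auto.
{ intros x; now apply is_derive_flux. }
exists z; split; [| exact (conj Hpos (conj Hmax (conj Hneg Hmin)))].
intros x; split.
- intros [Hx E].
  destruct (Rtotal_order x z) as [H | [H | H]]; [exfalso | easy | exfalso].
  + generalize (Hpos x ltac:(lra)); lra.
  + generalize (Hneg x ltac:(lra)); lra.
- intros ->; easy.
Qed.

Theorem theorem4p1 :
  1 / 2 < d1_tilde /\ d1_tilde < d0_tilde /\ d0_tilde < d1_bar /\
  exists r1_bar r3 r4 : R -> R,
    (* codomains *)
    (forall d, 1 / 2 <= d <= d1_bar -> 1 <= r1_bar d) /\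
    (forall d, d1_tilde <= d -> 1 <= r3 d) /\
    (forall d, d1_tilde <= d < 1 -> 1 <= r4 d) /\
    (* 1.(i) *)
    increasing_on (fun d => d1_tilde <= d < 1) r4 /\
    decreasing_on (fun d => 1 / 2 <= d <= d1_bar) r1_bar /\
    decreasing_on (fun d => d1_tilde <= d) r3 /\
    continuous_on (fun d => d1_tilde <= d < 1) r4 /\
    continuous_on (fun d => 1 / 2 <= d <= d1_bar) r1_bar /\
    continuous_on (fun d => d1_tilde <= d) r3 /\
    filterlim r4 (at_left 1) (Rbar_locally p_infty) /\
    (* 1.(ii) *)
    (forall d, d1_tilde <= d <= d1_bar ->
      (d = d0_tilde -> r1_bar d = r3 d) /\
      (d <> d0_tilde -> r1_bar d < r3 d)) /\
    (* 2.(i) *)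
    (forall d r, 1 / 2 <= d < d1_tilde -> 1 <= r ->
      let G := two_lane_flux d (1 - d) r in
      (r <= r1_bar d -> strictly_concave G) /\
      (r1_bar d < r -> two_inflexion_points G)) /\
    (* 2.(ii) *)
    (forall d r, d1_tilde <= d < d0_tilde -> 1 <= r ->
      let G := two_lane_flux d (1 - d) r in
      (r <= r1_bar d -> strictly_concave G) /\
      (r1_bar d < r < r3 d \/ r4 d < r -> two_inflexion_points G) /\
      (r3 d <= r <= r4 d -> single_inflexion_point G)) /\
    (* 2.(iii) *)
    (forall d r, d0_tilde <= d < 1 -> 1 <= r ->
      let G := two_lane_flux d (1 - d) r in
      (r <= r3 d -> strictly_concave G) /\
      (r3 d < r < r4 d -> single_inflexion_point G) /\
      (r4 d < r -> two_inflexion_points G)) /\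
    (* 2.(iv) *)
    r3 1 = 1 + sqrt 2 /\
    (forall r, 1 <= r ->
      let G := two_lane_flux 1 (1 - 1) r in
      (r <= r3 1 -> strictly_concave G) /\
      (r3 1 < r -> single_inflexion_point G)) /\
    (* 2.(v) *)
    (forall d r, 1 < d -> 1 <= r ->
      let G := two_lane_flux d (1 - d) r in
      (r <= r3 d ->
        positive_on (fun x => 0 < x < 2) G /\ strictly_concave G) /\
      (r3 d < r <= d / (d - 1) ->
        positive_on (fun x => 0 < x < 2) G /\ single_inflexion_point G) /\
      (d / (d - 1) < r ->
        single_inflexion_point G /\
        exists z,
          (forall x, 0 < x < 2 /\ G x = 0 <-> x = z) /\
          positive_on (fun x => 0 < x < z) G /\
          (exists! x, 0 < x < z /\ local_max G x) /\
          negative_on (fun x => z < x < 2) G /\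
          (exists! x, z < x < 2 /\ local_min G x))).
Proof.
assert (Hb1 := d1_tilde_bounds); assert (Hb0 := d0_tilde_bounds).
assert (Hbb := d1_bar_bounds).
do 3 (split; [lra|]).
exists r1_bar, r3, r4.
split; [intros d _; apply r1_bar_ge1|].
split; [intros d Hd; destruct (r3_spec d Hd); lra|].
split; [intros d Hd; destruct (r4_spec d Hd); generalize rs_gt; lra|].
split; [exact r4_increasing|].
split; [exact r1_bar_decreasing|].
split; [exact r3_decreasing|].
split; [exact r4_continuous|].
split; [exact r1_bar_continuous|].
split; [exact r3_continuous|].
split; [exact r4_limit|].
split; [exact r1_bar_vs_r3|].
split.
{ intros d r Hd Hr G; split; intros H.
  - apply strictly_concave_below_r1_bar; lra.
  - now apply flux_case_i. }
split.
{ intros d r Hd Hr G.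
  assert (H13 : r1_bar d < r3 d) by (apply r1_bar_vs_r3; lra).
  assert (H34 : r3 d <= r4 d).
  { destruct (r3_spec d); [lra|]; destruct (r4_spec d); lra. }
  split; [| split]; intros H.
  - apply strictly_concave_below_r1_bar; lra.
  - apply flux_case_ii_two; lra.
  - apply flux_case_ii_single; lra. }
split.
{ intros d r Hd Hr G; split; [| split]; intros H.
  - apply flux_concave_below_r3; lra.
  - destruct (r3_spec d); [lra|].
    apply flux_single_of_hg; [lra | lra | apply hg_between; lra].
  - now apply flux_case_iii_two. }
assert (Hsingle : forall d r, 1 <= d -> r3 d < r ->
  single_inflexion_point (two_lane_flux d (1 - d) r)).
{ intros d r Hd H; destruct (r3_spec d); [lra|].
  apply flux_single_of_hg; [lra | lra | apply hg_above_r3; lra]. }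
split; [exact r3_1|].
split.
{ intros r Hr G; split; intros H.
  - apply flux_concave_below_r3; lra.
  - apply Hsingle; lra. }
intros d r Hd Hr G; destruct (r3_spec d) as [H3 _]; [lra|].
split; [| split]; intros H.
(* Positivity is drawn from concavity and the zeros at both endpoints, so [r3 d] and [d / (d - 1)]
   are not compared. *)
- assert (Hc : strictly_concave G) by (apply flux_concave_below_r3; lra).
  split; [| easy].
  destruct (flux_endpoints d r Hr); now apply positive_of_strictly_concave.
- split; [apply flux_positive | apply Hsingle]; lra.
- apply flux_sign_change; [easy | | easy].
  assert (1 < d / (d - 1)); [| lra].
  replace (d / (d - 1)) with (1 + / (d - 1)) by (field; lra).
  assert (0 < / (d - 1)) by (apply Rinv_0_lt_compat; lra); lra.
Qed.
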